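(* Let $(Y^n)_{n\ge 1}$ be a sequence of centred Gaussian vectors $Y^n=(Y^{(n)}_1,\dots,Y^{(n)}_n)$ such that for every $n\ge 1$ the elements $Y^{(n)}_k$, $k=1,\dots,n$, belong to the first Wiener chaos, and assume that the sequence has finite non-zero energy. Let $\lambda^n_1,\dots,\lambda^n_n$ be the eigenvalues of the covariance matrix of $Y^n$, let $\lambda^*(n)=\max_{k=1,\dots,n}|\lambda^n_k|$, and let $V_n=\sum_{k=1}^n\left[(Y^{(n)}_k)^2-\mathbb{E}(Y^{(n)}_k)^2\right]$. Then there exists a constant $C>0$ (independent of $n$) such that $$\sup_{x\in\mathbb{R}}\left|\mathbb{P}\left(\frac{V_n}{\sqrt{\mathrm{Var}(V_n)}}<x\right)-\mathbb{P}(Z<x)\right|\le C\sqrt{n}\,\lambda^*(n),$$ where $Z$ is a standard normal random variable. Hence if $\lambda^*(n)=o\left(\frac{1}{\sqrt n}\right)$, then $\frac{V_n}{\sqrt{\mathrm{Var}(V_n)}}\to\mathcal{N}(0,1)$ in distribution. In particular, if $$\max_{1\le j\le n}\sum_{k=1}^n\left|\mathbb{E}[Y^{(n)}_kY^{(n)}_j]\right|=o\left(\frac{1}{\sqrt n}\right),$$ then $\frac{V_n}{\sqrt{\mathrm{Var}(V_n)}}\to\mathcal{N}(0,1)$ in distribution.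
   Context: The first Wiener chaos of a separable centred Gaussian process $X$ is the closed linear subspace of $L^2(\Omega)$ spanned by the random variables of $X$; all its elements are centred and jointly Gaussian. The covariance matrix of $Y^n$ has entries $\mathbb{E}[Y^{(n)}_jY^{(n)}_k]$. Finite non-zero energy means that $\varepsilon(Y)=\lim_{n\to\infty}\sum_{k=1}^n\mathbb{E}[(Y^{(n)}_k)^2]$ exists and $0<\varepsilon(Y)<\infty$. $a_n=o(b_n)$ means $|a_n|/|b_n|\to0$. It is understood that $\mathrm{Var}(V_n)>0$. *)

(* Defs.v *)
From HB Require Import structures.
From mathcomp Require Import all_boot all_order all_algebra.
From mathcomp Require Import all_classical all_reals all_analysis.
From mathcomp Require Import measurable_realfun.

Set Implicit Arguments.
Unset Strict Implicit.
Unset Printing Implicit Defensive.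

Import Order.TTheory GRing.Theory Num.Theory.
Import numFieldNormedType.Exports.

Local Open Scope classical_set_scope.
Local Open Scope ring_scope.

Section GaussianFamilies.
Context {d : measure_display} {T : measurableType d} {R : realType}.
Variable P : probability T R.

(* The degenerate law is separated out because [normal_prob 0 0] is, in the
   library, the uniform law on [0, 1]. *)
Definition centred_normal (F : {RV P >-> R}) : Prop :=
  exists2 s : R, 0 <= s &
    forall A : set R, measurable A ->
      distribution P F A = if s == 0 then \d_(0 : R) A else normal_prob 0 s A.

Definition linear_span {I : Type} (X : I -> {RV P >-> R}) :
    set {RV P >-> R} :=
  [set F | exists (m : nat) (t : 'I_m -> I) (a : 'I_m -> R),
     F = \sum_(i < m) a i *: X (t i)].

(* For [I := 'I_n] this says that [X] is a centred Gaussian vector, for a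
   general [I] that [X] is a centred Gaussian process indexed by [I]. *)
Definition centred_gaussian {I : Type} (X : I -> {RV P >-> R}) : Prop :=
  forall F, linear_span X F -> centred_normal F.

Definition L2_closure (S : set {RV P >-> R}) : set {RV P >-> R} :=
  [set F | (F : T -> R) \in Lfun P 2%:E /\
     forall e : R, 0 < e ->
       exists2 G, S G & ('N[P]_2%:E [EFin \o (F \- G)%R] < e%:E)%E].

(* Elements of L^2 are represented by square integrable random variables, so
   the chaos is closed under almost sure equality. *)
Definition first_chaos {I : Type} (X : I -> {RV P >-> R}) :
    set {RV P >-> R} :=
  L2_closure (linear_span X).

(* Separability in the L^2 sense: the Gaussian Hilbert space of [X] has a
   countable dense subset. *)
Definition separable_process {I : Type} (X : I -> {RV P >-> R}) : Prop :=
  exists u : nat -> {RV P >-> R},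
    range u `<=` first_chaos X /\ first_chaos X `<=` L2_closure (range u).

End GaussianFamilies.

Section QuadraticFunctional.
Context {d : measure_display} {T : measurableType d} {R : realType}.
Variable P : probability T R.

(* The expectations below are those of products of square integrable
   variables, hence finite, and [fine] loses nothing. *)
Definition covmx {n : nat} (Y : 'I_n -> {RV P >-> R}) : 'M[R]_n :=
  \matrix_(j, k) fine 'E_P[Y j * Y k].

Definition finite_nonzero_energy (Y : forall n, 'I_n -> {RV P >-> R}) : Prop :=
  exists2 eps : R, 0 < eps &
    (\sum_(k < n) fine 'E_P[Y n k ^+ 2]) @[n --> \oo] --> eps.

Definition centred_square_sum {n : nat} (Y : 'I_n -> {RV P >-> R}) :
    {RV P >-> R} :=
  \sum_(k < n) (Y k ^+ 2 - cst (fine 'E_P[Y k ^+ 2])).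

Definition normalized (F : {RV P >-> R}) : {RV P >-> R} :=
  (Num.sqrt (fine 'V_P[F]))^-1 *: F.

(* Convergence of the distribution functions at every continuity point of the
   limiting one. *)
Definition cvg_in_distribution (F : nat -> {RV P >-> R})
    (nu : probability (measurableTypeR R) R) : Prop :=
  forall x : R, {for x, continuous (fun y : R => nu `]-oo, y]%classic)} ->
    cdf (F n) x @[n --> \oo] --> nu `]-oo, x]%classic.

End QuadraticFunctional.

(* [lam] lists the eigenvalues of [A] with their algebraic multiplicities. *)
Definition eigenvalues_of {R : realType} {n : nat} (A : 'M[R]_n)
    (lam : 'I_n -> R) : Prop :=
  char_poly A = \prod_(k < n) ('X - (lam k)%:P).

(* Main.v *)
Require Import Defs.
From HB Require Import structures.
From mathcomp Require Import all_boot all_order all_algebra.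
From mathcomp Require Import all_classical all_reals all_analysis.
From mathcomp Require Import measurable_realfun.
From mathcomp Require Import ring lra.

Set Implicit Arguments.
Unset Strict Implicit.
Unset Printing Implicit Defensive.

Import Order.TTheory GRing.Theory Num.Theory.
Import numFieldNormedType.Exports.

Local Open Scope classical_set_scope.
Local Open Scope ring_scope.

(** Let [Y] be a centred Gaussian vector with covariance matrix [C], [W] its
    squared norm and [V = W - tr C]. In coordinates that diagonalize [C], the
    variable [V] is a sum of independent terms [lam_k * (N_k ^ 2 - 1)], and
    integration by parts in each [N_k] gives
      [E (V * f V) = E (K * f' V)]   with the Stein kernel   [K = 2 * Y^T C Y].
    The kernel has mean [Var V = 2 * tr C^2] and variance [8 * tr C^4]. Stein's
    equation [f' x - x * f x = h x - E (h N)] has, for [0 <= h <= 1], a solution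
    with [`|f'| <= 2]; inserting the normalized [V] bounds the error for the test
    function [h] by [2 * E `|1 - K / Var V|], hence by twice the relative standard
    deviation of the kernel, which is
      [sqrt (8 * tr C^4) / tr C^2 <= sqrt 8 * lamstar / sqrt (tr C^2)].
    The bound does not see how steep [h] is, so it passes to indicators of
    half-lines. By the Cauchy-Schwarz inequality [tr C^2 >= (tr C)^2 / n], and
    [tr C] converges to the energy, whence the factor [sqrt n]. The last claim
    follows from Gershgorin's bound on the eigenvalues.

    The kernel identity is obtained without identifying the joint law of [Y], from
    the normality of the linear combinations alone:
    - [lin_sin_ibp] is integration by parts for the sine of a linear combination,
      where two uncorrelated combinations are separated by comparing cosines of
      their sum and of their difference;
    - [damping_exp_sum] multiplies the sine by [exp (- s * W)], a limit of powers of
      cosines, and letting the frequency of the sine vanish gives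
      [expR_sqnorm_ibp], which is the identity for [f = exp (- s * _)];
    - [kernel_of_exponentials] extends it to all [f] with a bounded continuous
      derivative, by Bernstein polynomials in the variable [exp (- W)].
    Stein's equation is solved in [stein_equation] and combined with the kernel in
    [stein_bound]; [kolmogorov_le] passes to distribution functions. The moments of
    the kernel come from Wick's formula [wick4], and traces of powers of [C] are
    expressed by eigenvalues through [eigenvalues_of_sqr]. *)

(** * Real-valued integrals *)

Notation mfun f := (measurable_fun [set: _] f).

Section Integrals.
Context {d : measure_display} {T : measurableType d} {R : realType}.
Variable mu : {measure set T -> \bar R}.

Implicit Types f g : T -> R.

(** Integrals are taken in the field itself, so that ring tactics apply to them;
    the measure is a probability or the Lebesgue measure on the line. *)
Definition L1 (f : T -> R) := mu.-integrable [set: T] (EFin \o f).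
Definition Ex (f : T -> R) : R := \int[mu]_w f w.

Lemma L1_measurable f : L1 f -> mfun f.
Proof. by move=> /integrableP[/measurable_EFinP]. Qed.

Lemma L1_le f g : mfun f -> L1 g -> (forall w, `|f w| <= g w) -> L1 f.
Proof.
move=> mf ig fg; apply: (le_integrable measurableT _ _ ig).
  exact/measurable_EFinP.
by move=> w _ /=; rewrite lee_fin (le_trans (fg w))// ler_norm.
Qed.

Lemma L1D f g : L1 f -> L1 g -> L1 (fun w => f w + g w).
Proof. by move=> i1 i2; have := integrableD measurableT i1 i2. Qed.

Lemma L1B f g : L1 f -> L1 g -> L1 (fun w => f w - g w).
Proof. by move=> i1 i2; have := integrableB measurableT i1 i2. Qed.

Lemma L1Z k f : L1 f -> L1 (fun w => k * f w).
Proof. by move=> i1; have := integrableZl measurableT k i1. Qed.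

Lemma L1_norm f : L1 f -> L1 (fun w => `|f w|).
Proof. by move=> i1; have := integrable_abse i1. Qed.

Lemma eq_L1 f g : f =1 g -> L1 f -> L1 g.
Proof. by move=> /funext ->. Qed.

Lemma L1_0 : L1 (fun _ => 0).
Proof. exact: integrable0. Qed.

Lemma L1_sum (I : Type) (r : seq I) (Q : pred I) (F : I -> T -> R) :
  (forall i, L1 (F i)) -> L1 (fun w => \sum_(i <- r | Q i) F i w).
Proof.
move=> h; elim: r => [|i r ih].
  by apply: eq_L1 L1_0 => w; rewrite big_nil.
case Qi : (Q i).
  by apply: eq_L1 (L1D (h i) ih) => w; rewrite big_cons Qi.
by apply: eq_L1 ih => w; rewrite big_cons Qi.
Qed.

Lemma ExD f g : L1 f -> L1 g -> Ex (fun w => f w + g w) = Ex f + Ex g.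
Proof. by move=> ? ?; rewrite /Ex RintegralD. Qed.

Lemma ExB f g : L1 f -> L1 g -> Ex (fun w => f w - g w) = Ex f - Ex g.
Proof. by move=> ? ?; rewrite /Ex RintegralB. Qed.

Lemma ExZ k f : L1 f -> Ex (fun w => k * f w) = k * Ex f.
Proof. by move=> ?; rewrite /Ex RintegralZl. Qed.

Lemma eq_Ex f g : f =1 g -> Ex f = Ex g.
Proof. by move=> /funext ->. Qed.

Lemma Ex_0 : Ex (fun _ => 0) = 0.
Proof. by rewrite /Ex /Rintegral integral0. Qed.

Lemma Ex_sum (I : Type) (r : seq I) (Q : pred I) (F : I -> T -> R) :
  (forall i, L1 (F i)) ->
  Ex (fun w => \sum_(i <- r | Q i) F i w) = \sum_(i <- r | Q i) Ex (F i).
Proof.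
move=> h; elim: r => [|i r ih].
  by rewrite big_nil -[RHS]Ex_0; apply: eq_Ex => w; rewrite big_nil.
rewrite big_cons; case Qi : (Q i).
  rewrite -ih -ExD//; last exact: L1_sum.
  by apply: eq_Ex => w; rewrite big_cons Qi.
by rewrite -ih; apply: eq_Ex => w; rewrite big_cons Qi.
Qed.

Lemma le_Ex f g : L1 f -> L1 g -> (forall w, f w <= g w) -> Ex f <= Ex g.
Proof. by move=> ? ? h; apply: le_Rintegral. Qed.

Lemma Ex_ge0 f : (forall w, 0 <= f w) -> 0 <= Ex f.
Proof. by move=> h; apply: Rintegral_ge0. Qed.

Lemma normr_Ex f : L1 f -> `|Ex f| <= Ex (fun w => `|f w|).
Proof. by move=> h; apply: le_normr_Rintegral. Qed.

Lemma dominated_Ex (f_ : nat -> T -> R) (f g : T -> R) :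
  (forall n, mfun (f_ n)) -> mfun f ->
  (forall w, f_ n w @[n --> \oo] --> f w) ->
  L1 g -> (forall n w, `|f_ n w| <= g w) ->
  L1 f /\ Ex (f_ n) @[n --> \oo] --> Ex f.
Proof.
move=> mf_ mf ff ig fg.
have [||||i _ h] := @dominated_convergence _ T R mu setT measurableT
  (fun n => EFin \o f_ n) (EFin \o f) (EFin \o g) _ _ _ ig _.
- by move=> n; apply/measurable_EFinP.
- exact/measurable_EFinP.
- by apply: aeW => w _ /=; apply: cvg_EFin (ff w); exact: nearW.
- by apply: aeW => w n _ /=; rewrite lee_fin fg.
split => //; apply: fine_cvg.
by rewrite fineK//; exact: integrable_fin_num.
Qed.

End Integrals.

Section ProbabilityIntegrals.
Context {d : measure_display} {T : measurableType d} {R : realType}.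
Variable P : probability T R.

Implicit Types f : T -> R.

Lemma L1_cst k : L1 P (fun _ => k).
Proof. exact: finite_measure_integrable_cst. Qed.

Lemma Ex_cst k : Ex P (fun _ => k) = k.
Proof.
rewrite /Ex Rintegral_cst// (_ : (P : {measure set T -> \bar R}) setT = 1%E).
  by rewrite /= mulr1.
exact: probability_setT.
Qed.

(** Integrate the square of the deviation of [`|f|] from its mean. *)
Lemma Ex_norm_le_sqrt f : mfun f -> L1 P (fun w => f w ^+ 2) ->
  L1 P f /\ Ex P (fun w => `|f w|) <= Num.sqrt (Ex P (fun w => f w ^+ 2)).
Proof.
move=> mf i2.
have i1 : L1 P f.
  apply: (@L1_le _ _ _ _ _ (fun w => 1 + f w ^+ 2)) => //.
    by apply: L1D => //; exact: L1_cst.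
  move=> w; have := sqr_ge0 (`|f w| - 1); rewrite sqrrB -normrX expr1n.
  rewrite (ger0_norm (sqr_ge0 _)) mulr1 => h.
  have := normr_ge0 (f w); lra.
split=> //; set m := Ex _ (fun w => `|f w|).
have m0 : 0 <= m by apply: Ex_ge0.
rewrite -(ler_pXn2r (_ : 0 < 2)%N)// ?nnegrE ?sqrtr_ge0//.
rewrite sqr_sqrtr; last by apply: Ex_ge0 => w; exact: sqr_ge0.
have h : 0 <= Ex P (fun w => f w ^+ 2 - 2 * m * `|f w| + m ^+ 2).
  apply: Ex_ge0 => w; have := sqr_ge0 (`|f w| - m).
  by rewrite sqrrB -normrX (ger0_norm (sqr_ge0 _)); lra.
have ia : L1 P (fun w => 2 * m * `|f w|) by apply: L1Z; exact: L1_norm.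
have ib : L1 P (fun w => f w ^+ 2 - 2 * m * `|f w|) by exact: L1B.
rewrite (ExD ib (L1_cst _)) (ExB i2 ia) (ExZ _ (L1_norm i1)) Ex_cst -/m in h.
move: h; lra.
Qed.

End ProbabilityIntegrals.

(** * Primitives on the real line *)

Section RealLine.
Context {R : realType}.
Notation mu := (@lebesgue_measure R).
Implicit Types (f g k H : R -> R) (s x : R).

Lemma continuous_mfun f : continuous f -> mfun f.
Proof. exact: continuous_measurable_fun. Qed.

Lemma is_derive_continuous f f' : (forall x, is_derive x 1 f (f' x)) ->
  continuous f.
Proof.
move=> df x; apply: differentiable_continuous; apply/derivable1_diffP.
by have [] := df x.
Qed.

Lemma antiderivative k : continuous k -> L1 mu k ->
  exists K : R -> R, [/\ forall x, is_derive x 1 K (k x),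
    K (- n%:R) @[n --> \oo] --> 0 & K n%:R @[n --> \oo] --> Ex mu k].
Proof.
move=> ck ik; pose K x := \int[mu]_(t in `]-oo, x]) k t; exists K.
have KE x : K x = Ex mu (k \_ `]-oo, x]) by rewrite /K Rintegral_mkcond.
have dom (a : nat -> R) (l : R -> R) : mfun l ->
    (forall x, (k \_ `]-oo, a n]) x @[n --> \oo] --> l x) ->
    K (a n) @[n --> \oo] --> Ex mu l.
  move=> ml kl; rewrite (_ : (fun n => K (a n)) =
    (fun n => Ex mu (k \_ `]-oo, a n]))); last by apply/funext => n; exact: KE.
  have [|||//] := @dominated_Ex _ _ _ mu (fun n => k \_ `]-oo, a n]) l
    (fun x => `|k x|) _ ml kl.
  - move=> n; apply/measurable_restrict => //.
    by rewrite setTI; apply: measurable_funTS; exact: continuous_mfun.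
  - exact: L1_norm.
  - by move=> n x; rewrite patchE; case: ifPn => // _; rewrite normr0.
split.
- move=> x; have xu : x < x + 1 by rewrite ltrDl.
  have iu : mu.-integrable `]-oo, x + 1] (EFin \o k).
    exact: (integrableS measurableT).
  have [|dK eK] := continuous_FTC1 xu iu _ (ck x); first by rewrite ltNyr.
  by apply: (DeriveDef dK); rewrite -derive1E; exact: eK.
- rewrite -(@Ex_0 _ _ _ mu); apply: dom => // x.
  apply: cvg_near_cst; near=> n; rewrite patchE ifF//; apply/negP.
  rewrite inE/= in_itv/= => xn.
  have : `|x| < n%:R by near: n; exact: nbhs_infty_gtr.
  by rewrite ltr_norml => /andP[]; rewrite ltNge xn.
- apply: dom => [|x]; first exact: continuous_mfun.
  apply: cvg_near_cst; near=> n; rewrite patchE ifT// inE/= in_itv/=.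
  rewrite (le_trans (ler_norm _))//.
  by near: n; exact: nbhs_infty_ger.
Unshelve. all: by end_near. Qed.

(** A function vanishing at both ends of the line has a derivative of zero
    total mass; this is what integration by parts on the line amounts to. *)
Lemma Ex_derivative_eq0 H k : continuous k -> L1 mu k ->
  (forall x, is_derive x 1 H (k x)) ->
  H (- n%:R) @[n --> \oo] --> 0 -> H n%:R @[n --> \oo] --> 0 -> Ex mu k = 0.
Proof.
move=> ck ik dH H0 H1; have [K [dK K0 K1]] := antiderivative ck ik.
have HK x : H x - K x = H 0 - K 0.
  apply: (@is_derive_0_is_cst _ (fun x => H x - K x)) => y.
  have := dH y; have := dK y => h1 h2.
  by apply: is_derive_eq; rewrite subrr.
have c0 : H 0 - K 0 = 0.
  have h : H (- n%:R) - K (- n%:R) @[n --> \oo] --> (0 - 0 : R) by exact: cvgB.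
  rewrite subr0 in h; move: h; under eq_cvg do rewrite HK.
  by move/(cvg_unique _)/(_ (cvg_cst _)) => ->.
apply: cvg_unique K1 _ => //.
rewrite (_ : (fun n => K n%:R) = (fun n => H n%:R)) //.
by apply/funext => n; have /eqP := HK n%:R; rewrite c0 subr_eq0 => /eqP.
Qed.

End RealLine.

(** * The normal law and its density *)

Section NormalDensity.
Context {R : realType}.
Notation mu := (@lebesgue_measure R).
Implicit Types (f g : R -> R) (s x : R).
Import HBNNSimple.

Lemma ge0_integral_normal_prob s (f : measurableTypeR R -> \bar R) :
  measurable_fun setT f -> (forall x, 0 <= f x)%E ->
  (\int[normal_prob 0 s]_x f x = \int[mu]_x (f x * (normal_pdf 0 s x)%:E))%E.
Proof.
move=> mf f0.
have mp : measurable_fun setT (fun x : measurableTypeR R => (normal_pdf 0 s x)%:E).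
  by apply/measurable_EFinP; apply: measurable_normal_pdf.
have p0 x : (0 <= (normal_pdf 0 s x)%:E)%E by rewrite lee_fin normal_pdf_ge0.
have indic A : measurable A -> (\int[normal_prob 0 s]_x (\1_A x)%:E =
    \int[mu]_x ((\1_A x)%:E * (normal_pdf 0 s x)%:E))%E.
  move=> mA; rewrite integral_indic// setIT.
  rewrite -[LHS]/(\int[mu]_(x in A) (normal_pdf 0 s x)%:E)%E integral_mkcond.
  apply: eq_integral => x _; rewrite patchE indicE.
  by case: ifPn => _; rewrite ?mul1e ?mul0e.
have simple (h : {nnsfun measurableTypeR R >-> R}) : (\int[normal_prob 0 s]_x (h x)%:E =
    \int[mu]_x ((h x)%:E * (normal_pdf 0 s x)%:E))%E.
  have m_indic r : measurable_fun setT
      (fun x : measurableTypeR R => (r * \1_(h @^-1` [set r]) x)%:E).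
    apply/measurable_EFinP; apply: measurable_funM; first exact: measurable_cst.
    by apply: measurable_indic; exact: measurable_funPTI.
  under [LHS]eq_integral do rewrite fimfunE -fsumEFin//.
  rewrite [LHS]ge0_integral_fsum//; last first.
    by move=> n x _; rewrite EFinM nnfun_muleindic_ge0.
  under [RHS]eq_integral.
    move=> x xD; rewrite fimfunE -fsumEFin// ge0_mule_fsuml; last first.
      by move=> r; rewrite EFinM nnfun_muleindic_ge0.
    over.
  rewrite [RHS]ge0_integral_fsum//; last 2 first.
    - by move=> r; apply: emeasurable_funM => //; exact: m_indic.
    - by move=> n x _; rewrite mule_ge0// EFinM nnfun_muleindic_ge0.
  apply: eq_fsbigr => r /set_mem[y _ ry].
  rewrite integralZl_indic_nnsfun// indic// -ge0_integralZl//.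
  - by apply: eq_integral => x _; rewrite EFinM muleA.
  - by apply: emeasurable_funM => //; exact/measurable_EFinP.
  - by move=> x _; rewrite mule_ge0.
  - by rewrite lee_fin -ry.
pose f_ := nnsfun_approx measurableT mf.
have fcvg x : (f_ n x)%:E @[n --> \oo] --> f x by exact: cvg_nnsfun_approx.
have fnd x : nondecreasing_seq (fun n => (f_ n x)%:E).
  move=> m n mn; rewrite lee_fin.
  by have /lefP := nd_nnsfun_approx measurableT mf mn; exact.
transitivity (lim (\int[normal_prob 0 s]_x (f_ n x)%:E @[n --> \oo])%E).
  rewrite -monotone_convergence//=.
  - by apply: eq_integral => x _; apply/esym/cvg_lim.
  - by move=> n; exact/measurable_EFinP/measurable_funTS.
  - by move=> n x _; rewrite lee_fin.
transitivity (lim (\int[mu]_x ((f_ n x)%:E * (normal_pdf 0 s x)%:E)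
    @[n --> \oo])%E).
  by apply: congr_lim; apply/funext => n /=; exact: simple.
rewrite -monotone_convergence//=.
- apply: eq_integral => x _; apply/cvg_lim => //.
  by apply: cvgeZr.
- by move=> n; apply: emeasurable_funM => //; exact/measurable_EFinP.
- by move=> n x _; rewrite mule_ge0// lee_fin.
- by move=> x _ m n mn; rewrite lee_wpmul2r// fnd.
Qed.

End NormalDensity.

Section NormalMoments.
Context {R : realType}.
Notation mu := (@lebesgue_measure R).
Implicit Types (f g : R -> R) (s x : R).

Lemma normal_pdf_expR s x : s != 0 ->
  normal_pdf 0 s x = normal_peak s * expR (- x ^+ 2 / (s ^+ 2 *+ 2)).
Proof. by move=> s0; rewrite normal_pdfE// /normal_fun subr0. Qed.

Lemma is_derive_normal_pdf s x : s != 0 ->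
  is_derive x 1 (normal_pdf 0 s) (- x / s ^+ 2 * normal_pdf 0 s x).
Proof.
move=> s0; rewrite normal_pdf_expR//.
have -> : normal_pdf 0 s =
    (fun y => normal_peak s * expR ((- (s ^+ 2 *+ 2)^-1) * y ^+ 2)).
  by apply/funext => y; rewrite normal_pdf_expR//; congr (_ * expR _); field.
apply: is_derive_eq.
rewrite /GRing.scale/= ?mulr1.
have -> : - (s ^+ 2 *+ 2)^-1 * x ^+ 2 = - x ^+ 2 / (s ^+ 2 *+ 2).
  by rewrite mulNr mulrC mulNr.
field.
by rewrite s0.
Qed.

Lemma ge0_expR_sqr (y : R) : 0 <= y -> y ^+ 2 <= 2 * expR y.
Proof.
by move=> y0; have := @expR_ge1Dxn _ y 1 y0; rewrite -[2`!]/2%N; lra.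
Qed.

(** Doubling the standard deviation leaves a Gaussian factor that absorbs fourth
    powers; integrability of polynomials thus reduces to that of a normal
    density. *)
Lemma normal_pdf_quartic s : s != 0 -> exists2 A : R, 0 <= A &
  forall x, x ^+ 4 * normal_pdf 0 s x <= A * normal_pdf 0 (2 * s) x.
Proof.
move=> s0; have s20 : 2 * s != 0 by rewrite mulf_neq0.
have p0 := normal_peak_gt0 s20.
(* [x ^+ 2 / c] is the gap between the exponents of the two densities *)
pose c := (3 / 8 / s ^+ 2)^-1.
have c0 : 0 < c by rewrite invr_gt0 !divr_gt0// exprn_even_gt0.
exists (2 * c ^+ 2 * normal_peak s / normal_peak (2 * s)).
  by rewrite divr_ge0 ?normal_peak_ge0// mulr_ge0 ?normal_peak_ge0// mulr_ge0// sqr_ge0.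
move=> x; rewrite !normal_pdf_expR//; set a := expR _; set b := expR _.
have y0 : 0 <= x ^+ 2 / c by rewrite divr_ge0 ?sqr_ge0 ?ltW.
have ab : b = a * expR (x ^+ 2 / c).
  rewrite -expRD; congr expR; rewrite /c invrK. by field; rewrite s0.
have xc : x ^+ 4 = c ^+ 2 * (x ^+ 2 / c) ^+ 2.
  by field; rewrite gt_eqF.
have -> : 2 * c ^+ 2 * normal_peak s / normal_peak (2 * s) *
  (normal_peak (2 * s) * b) = normal_peak s * a * c ^+ 2 *
  (2 * expR (x ^+ 2 / c)) by rewrite ab; field; rewrite gt_eqF.
rewrite xc [leLHS](_ : _ =
  normal_peak s * a * c ^+ 2 * (x ^+ 2 / c) ^+ 2); last by ring.
apply: ler_wpM2l; last exact: ge0_expR_sqr.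
by rewrite mulr_ge0 ?sqr_ge0// mulr_ge0 ?normal_peak_ge0 ?expR_ge0.
Qed.

(** Including the degenerate law makes the integration by parts formula and the
    moments below hold for every [s]. *)
Definition normal_Ex s f : R :=
  if s == 0 then f 0 else Ex mu (fun x => f x * normal_pdf 0 s x).

Definition quartic_growth f :=
  exists A : R, forall x, `|f x| <= A * (1 + x ^+ 4).

Lemma L1_normal_pdf s : L1 mu (normal_pdf 0 s).
Proof. exact: integrable_normal_pdf. Qed.

Lemma L1_quartic_normal s f : s != 0 -> mfun f -> quartic_growth f ->
  L1 mu (fun x => f x * normal_pdf 0 s x).
Proof.
move=> s0 mf [A fA].
have [B B0 pB] := normal_pdf_quartic s0.
have p0 t x := normal_pdf_ge0 0 t x.
have A0 : 0 <= A by have := le_trans (normr_ge0 _) (fA 0); rewrite expr0n/= addr0 mulr1.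
apply: (@L1_le _ _ _ mu _ (fun x => A * normal_pdf 0 s x +
    A * B * normal_pdf 0 (2 * s) x)).
- by apply: measurable_funM => //; exact: measurable_normal_pdf.
- by apply: L1D; apply: L1Z; exact: L1_normal_pdf.
- move=> x; rewrite normrM (ger0_norm (p0 _ _)).
  apply: (@le_trans _ _ (A * (1 + x ^+ 4) * normal_pdf 0 s x)).
    by rewrite ler_wpM2r.
  rewrite mulrDr mulr1 mulrDl lerD2l -[leLHS]mulrA -[leRHS]mulrA.
  by apply: ler_wpM2l => //; exact: pB.
Qed.

Lemma normal_Ex_law d (T : measurableType d) (P : probability T R)
    (F : {RV P >-> R}) : centred_normal F ->
  exists2 s, 0 <= s & forall f, mfun f -> quartic_growth f ->
    L1 P (fun w => f (F w)) /\ Ex P (fun w => f (F w)) = normal_Ex s f.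
Proof.
move=> [s s0 law]; exists s => // f mf gf.
have mfF g : mfun g -> mfun (fun w => g (F w)).
  by move=> mg; exact: measurableT_comp.
(* the change of measure takes place in the extended reals, for nonnegative
   functions; real integrals follow by splitting off the negative part *)
have ge0 g : mfun g -> (forall x, 0 <= g x) ->
    (\int[P]_w (g (F w))%:E = if (s == 0)%R then (g 0)%:E
      else \int[mu]_x (g x * normal_pdf 0 s x)%:E)%E.
  move=> mg g0.
  have mEg : measurable_fun setT (EFin \o g : measurableTypeR R -> \bar R).
    exact/measurable_EFinP.
  pose F' : T -> measurableTypeR R := F.
  have mF' : measurable_fun setT F' := @measurable_funPT _ _ _ _ F.
  have Eg0 y : (0 <= (EFin \o g) y)%E by rewrite lee_fin.
  have := @ge0_integral_pushforward _ _ _ _ _ F' mF' P setT _ measurableT mEg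
    (fun y _ => Eg0 y).
  rewrite preimage_setT => <-.
  case: ifPn => s0'.
    transitivity (\int[\d_(0%R : measurableTypeR R)]_y (EFin \o g) y)%E.
      apply: eq_measure_integral => A mA _.
      by have := law A mA; rewrite s0'.
    by rewrite integral_dirac// diracT mul1e.
  transitivity (\int[normal_prob 0 s]_y (EFin \o g) y)%E.
    apply: eq_measure_integral => A mA _.
    by have := law A mA; rewrite (negbTE s0').
  by rewrite ge0_integral_normal_prob.
have mm g h : mfun g -> mfun h -> mfun (fun x : R => Num.max (g x) (h x)).
  exact: measurable_maxr.
have key g : mfun g -> quartic_growth g -> (forall x, 0 <= g x) ->
    L1 P (fun w => g (F w)) /\ Ex P (fun w => g (F w)) = normal_Ex s g.
  move=> mg gg g0; split.
    apply/integrableP; split; first exact/measurable_EFinP/mfF.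
    under eq_integral do rewrite /= ger0_norm//.
    rewrite ge0//; case: ifPn => s0'; first exact: ltry.
    have /integrableP[_] := L1_quartic_normal s0' mg gg.
    by under eq_integral do rewrite /= ger0_norm ?mulr_ge0 ?normal_pdf_ge0//.
  by rewrite /Ex /Rintegral ge0// /normal_Ex; case: ifP.
have grow g : mfun g -> quartic_growth g ->
    quartic_growth (fun x => Num.max (g x) 0).
  move=> _ [A gA]; exists A => x; apply: le_trans (gA x).
  by rewrite /Num.max; case: ifP => // _; rewrite normr0.
have mNf : mfun (fun x => - f x) by exact: measurable_funN.
have gNf : quartic_growth (fun x => - f x).
  by have [A gA] := gf; exists A => x; rewrite normrN.
have max0 (g : R -> R) x : 0 <= Num.max (g x) 0 by rewrite le_max lexx orbT.
have m0 : mfun (fun _ : R => 0 : R) by exact: measurable_cst.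
have [i1 e1] := key _ (mm _ _ mf m0) (grow _ mf gf) (max0 f).
have [i2 e2] := key _ (mm _ _ mNf m0) (grow _ mNf gNf) (max0 _).
have fE x : f x = Num.max (f x) 0 - Num.max (- f x) 0.
  rewrite /Num.max oppr_lt0; case: ltrgtP => [h|h|->].
  - by rewrite sub0r opprK.
  - by rewrite subr0.
  - by rewrite oppr0 subr0.
split; first by apply: eq_L1 (L1B i1 i2) => w; rewrite -fE.
rewrite (eq_Ex P (g := fun w => Num.max (f (F w)) 0 - Num.max (- f (F w)) 0)).
  rewrite ExB// e1 e2 /normal_Ex; case: ifPn => s0'; first by rewrite -fE.
  rewrite -ExB; last 2 first.
  - exact: L1_quartic_normal (mm _ _ mf m0) (grow _ mf gf).
  - exact: L1_quartic_normal (mm _ _ mNf m0) (grow _ mNf gNf).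
  by apply: eq_Ex => x; rewrite -mulrBl -fE.
by move=> w; rewrite -fE.
Qed.
End NormalMoments.

(** * Integration by parts and moments of the normal law *)

Section NormalIntegrationByParts.
Context {R : realType}.
Notation mu := (@lebesgue_measure R).
Implicit Types (f g : R -> R) (s x : R).

Lemma cvg_bounded_div (a : nat -> R) (M : R) :
  (forall n, n%:R * `|a n| <= M) -> a n @[n --> \oo] --> 0.
Proof.
move=> aM; have M0 : 0 <= M by have := aM 0%N; rewrite mul0r.
apply/cvgr0Pnorm_le => e e0; near=> n.
have n0 : 0 < n%:R :> R by rewrite ltr0n; near: n; exists 1%N.
have : M / e <= n%:R by near: n; exact: nbhs_infty_ger.
rewrite ler_pdivrMr// => Mn; rewrite -(ler_pM2l n0).
exact: le_trans (aM n) Mn.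
Unshelve. all: by end_near. Qed.

Lemma normal_ibp s g g' : (forall x, is_derive x 1 g (g' x)) ->
  continuous g' -> quartic_growth g' -> quartic_growth (fun x => x * g x) ->
  normal_Ex s (fun x => x * g x) = s ^+ 2 * normal_Ex s g'.
Proof.
move=> dg cg' gg' gxg; rewrite /normal_Ex.
case: ifPn => s0; first by rewrite (eqP s0) expr0n/= !mul0r.
have cg := is_derive_continuous dg.
have mxg : mfun (fun x => x * g x).
  by apply: measurable_funM => //; exact: continuous_mfun.
have i1 := L1_quartic_normal s0 (continuous_mfun cg') gg'.
have i2 := L1_quartic_normal s0 mxg gxg.
pose k x := g' x * normal_pdf 0 s x - (s ^+ 2)^-1 * (x * g x * normal_pdf 0 s x).
have ik : L1 mu k by apply: L1B => //; exact: L1Z.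
have cp := @continuous_normal_pdf _ 0 s s0.
have ck : continuous k.
  move=> x; apply: cvgB; first by apply: cvgM; [exact: cg'|exact: cp].
  apply: cvgM; first exact: cvg_cst.
  by apply: cvgM; [apply: cvgM; [exact: cvg_id|exact: cg]|exact: cp].
have dH x : is_derive x 1 (fun x => g x * normal_pdf 0 s x) (k x).
  have dp := is_derive_normal_pdf x s0; have dgx := dg x.
  apply: is_derive_eq; rewrite /GRing.scale/= /k; field.
  by rewrite s0.
have [A gA] := gxg; have [B B0 pB] := normal_pdf_quartic s0.
have A0 : 0 <= A.
  by have := le_trans (normr_ge0 _) (gA 0); rewrite expr0n/= addr0 mulr1.
have s20 : 2 * s != 0 by rewrite mulf_neq0.
have bd x : `|x * (g x * normal_pdf 0 s x)| <=
    A * (normal_peak s + B * normal_peak (2 * s)).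
  rewrite mulrA normrM (ger0_norm (normal_pdf_ge0 _ _ _)).
  apply: (@le_trans _ _ (A * (1 + x ^+ 4) * normal_pdf 0 s x)).
    by rewrite ler_wpM2r// normal_pdf_ge0.
  rewrite -(mulrA A) ler_wpM2l// mulrDl mul1r lerD ?normal_pdf_ub//.
  apply: le_trans (pB x) _; apply: ler_wpM2l => //; exact: normal_pdf_ub.
have k0 : Ex mu k = 0.
  apply: Ex_derivative_eq0 ck ik dH _ _; apply: cvg_bounded_div => n.
  - by apply: le_trans (bd (- n%:R)); rewrite [leRHS]normrM normrN normr_nat.
  - by apply: le_trans (bd n%:R); rewrite [leRHS]normrM normr_nat.
rewrite ExB ?ExZ in k0; [|exact: i2|exact: i1|exact: L1Z].
move/eqP: k0; rewrite subr_eq0 => /eqP ->.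
by rewrite mulrA divff ?mul1r// expf_neq0.
Qed.

Lemma quartic_growth_sqr : quartic_growth (fun x : R => x ^+ 2).
Proof.
exists 1 => x; rewrite ger0_norm ?sqr_ge0// mul1r.
have -> : x ^+ 4 = (x ^+ 2) ^+ 2 by rewrite -exprM.
by move: (sqr_ge0 (x ^+ 2 - 1)) (sqr_ge0 x); move: (x ^+ 2) => a; nra.
Qed.

Lemma quartic_growth1 : quartic_growth (fun _ : R => 1 : R).
Proof. by exists 1 => x; rewrite normr1 mul1r lerDl exprn_even_ge0. Qed.

Lemma quartic_growth_cos : quartic_growth (@cos R).
Proof.
by exists 1 => x; rewrite mul1r (le_trans (cos_max _))// lerDl exprn_even_ge0.
Qed.

Lemma normal_Ex1 s : normal_Ex s (fun _ => 1) = 1.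
Proof.
rewrite /normal_Ex; case: ifPn => // _.
rewrite (eq_Ex mu (g := normal_pdf 0 s)); last by move=> x; rewrite mul1r.
by rewrite /Ex /Rintegral integral_normal_pdf.
Qed.

Lemma normal_Ex_sqr s : normal_Ex s (fun x => x ^+ 2) = s ^+ 2.
Proof.
have h := @normal_ibp s (fun x => x) (fun _ => 1).
rewrite normal_Ex1 mulr1 in h; apply: h.
- by move=> x; exact: cvg_cst.
- exact: quartic_growth1.
- exact: quartic_growth_sqr.
Qed.

(** Integration by parts with [x], [x ^ 3] and [sin x]. *)
Lemma centred_normal_moments d (T : measurableType d) (P : probability T R)
    (F : {RV P >-> R}) : centred_normal F ->
  [/\ L1 P (fun w => F w ^+ 4),
    Ex P (fun w => F w ^+ 4) = 3 * Ex P (fun w => F w ^+ 2) ^+ 2 &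
    Ex P (fun w => F w * sin (F w)) =
      Ex P (fun w => F w ^+ 2) * Ex P (fun w => cos (F w))].
Proof.
move=> /normal_Ex_law[s s0 law].
have le14 x : `|x| <= 1 + x ^+ 4.
  have := sqr_ge0 (`|x| - 1); have := sqr_ge0 (`|x| ^+ 2 - 1).
  rewrite -(normrX 2) (ger0_norm (sqr_ge0 x)).
  have -> : x ^+ 4 = (x ^+ 2) ^+ 2 by rewrite -exprM.
  have : `|x| ^+ 2 = x ^+ 2 by rewrite -normrX ger0_norm// sqr_ge0.
  by move: (`|x|) (x ^+ 2) => a b; nra.
have g2 := quartic_growth_sqr; have gc := quartic_growth_cos.
have g4 : quartic_growth (fun x : R => x ^+ 4).
  by exists 1 => x; rewrite ger0_norm ?exprn_even_ge0// mul1r lerDr.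
have gs : quartic_growth (fun x : R => x * sin x).
  exists 1 => x; rewrite mul1r normrM (le_trans _ (le14 x))//.
  by rewrite ler_piMr// sin_max.
have mX n : mfun (fun x : R => x ^+ n) by exact: measurable_funX.
have mcos : mfun (@cos R) by apply: continuous_mfun; exact: continuous_cos.
have msin : mfun (fun x : R => x * sin x).
  apply: measurable_funM => //; apply: continuous_mfun; exact: continuous_sin.
have [_ e2] := law _ (mX 2%N) g2.
have [i4 e4] := law _ (mX 4%N) g4.
have [_ ec] := law _ mcos gc.
have [_ es] := law _ msin gs.
have v2 := normal_Ex_sqr s.
have v4 : normal_Ex s (fun x => x ^+ 4) = 3 * s ^+ 4.
  have : normal_Ex s (fun x => 3 * x ^+ 2) = 3 * normal_Ex s (fun x => x ^+ 2).
    rewrite /normal_Ex; case: ifPn => // s0'; rewrite -ExZ.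
      by apply: eq_Ex => x; rewrite mulrA.
    exact: L1_quartic_normal.
  rewrite v2 => h3.
  rewrite (_ : 3 * s ^+ 4 = s ^+ 2 * normal_Ex s (fun x => 3 * x ^+ 2)).
    apply: (@normal_ibp s (fun x => x ^+ 3)).
    - move=> x; apply: is_derive_eq; rewrite /GRing.scale/=. ring.
    - move=> x; apply: cvgM; [exact: cvg_cst|exact: exprn_continuous].
    - have [A gA] := g2; exists (3 * A) => x.
      by rewrite normrM ger0_norm// -mulrA ler_pM2l.
    - exact: g4.
  by rewrite h3; ring.
split => //.
  by rewrite e4 e2 v2 v4 -exprM.
rewrite es e2 ec v2; apply: normal_ibp => //.
exact: continuous_cos.
Qed.

(** A centred normal law is determined by its variance. *)
Lemma centred_normal_eq_cos d (T : measurableType d) (P : probability T R)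
    (F G : {RV P >-> R}) : centred_normal F -> centred_normal G ->
  Ex P (fun w => F w ^+ 2) = Ex P (fun w => G w ^+ 2) ->
  Ex P (fun w => cos (F w)) = Ex P (fun w => cos (G w)).
Proof.
have mcos : mfun (@cos R) by apply: continuous_mfun; exact: continuous_cos.
have mX : mfun (fun x : R => x ^+ 2) by exact: measurable_funX.
move=> /normal_Ex_law[s s0 Fs] /normal_Ex_law[t t0 Gt].
rewrite (Fs _ mX quartic_growth_sqr).2 (Gt _ mX quartic_growth_sqr).2.
rewrite !normal_Ex_sqr => /eqP; rewrite eqrXn2// => /eqP st.
by rewrite (Fs _ mcos quartic_growth_cos).2 (Gt _ mcos quartic_growth_cos).2 st.
Qed.

End NormalIntegrationByParts.

(** * Limits along vanishing frequencies *)

Section Sequences.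
Context {R : realType}.
Implicit Types (f : R -> R) (u : nat -> R) (x l : R).

Lemma cvg_slope f l u : is_derive (0 : R) 1 f l -> (forall n, u n != 0) ->
  u n @[n --> \oo] --> 0 ->
  (u n)^-1 * (f (u n) - f 0) @[n --> \oo] --> l.
Proof.
move=> [df <-] u0 cu.
move/cvg_ex : df => -[a fa]; have -> : 'D_1 f 0 = a by exact/cvg_lim.
have /cvgr_dnbhsP/(_ u (conj u0 cu)) := fa.
apply: cvg_trans; apply: near_eq_cvg; near=> n => /=.
by rewrite /GRing.scale/= mulr1 addr0.
Unshelve. all: by end_near. Qed.

Lemma cvg_eq u (v : nat -> R) l : u =1 v ->
  u n @[n --> \oo] --> l -> v n @[n --> \oo] --> l.
Proof. by move=> /funext ->. Qed.

Lemma cvg0_le u (v : nat -> R) : (forall n, `|u n| <= `|v n|) ->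
  v n @[n --> \oo] --> 0 -> u n @[n --> \oo] --> 0.
Proof.
move=> uv /cvgr0Pnorm_le v0; apply/cvgr0Pnorm_le => e e0.
by move: (v0 e e0); apply: filterS => n; exact: le_trans.
Qed.

Lemma cvg_sqr u l : u n @[n --> \oo] --> l -> u n ^+ 2 @[n --> \oo] --> l ^+ 2.
Proof. by move=> ul; rewrite expr2; exact: cvgM. Qed.

Lemma cvg_sum (I : Type) (r : seq I) (v : I -> nat -> R) (c : I -> R) :
  (forall i, v i n @[n --> \oo] --> c i) ->
  \sum_(i <- r) v i n @[n --> \oo] --> \sum_(i <- r) c i.
Proof.
move=> vc; elim: r => [|i r ih].
  by rewrite big_nil; under eq_fun do rewrite big_nil; exact: cvg_cst.
by rewrite big_cons; under eq_fun do rewrite big_cons; exact: cvgD.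
Qed.

(** Vanishing frequencies, by which one may divide. *)
Definition step n : R := n.+1%:R^-1.

Lemma step_neq0 n : step n != 0.
Proof. by rewrite invr_eq0. Qed.

Lemma cvg_step : step n @[n --> \oo] --> 0.
Proof. exact: cvg_harmonic. Qed.

Lemma cvg_sin_step x : (step n)^-1 * sin (step n * x) @[n --> \oo] --> x.
Proof.
have d : is_derive (0 : R) 1 (fun h => sin (h * x)) x.
  by apply: is_derive_eq; rewrite /GRing.scale/= mul0r cos0; ring.
have := cvg_slope d step_neq0 cvg_step; rewrite mul0r sin0.
by under eq_fun do rewrite subr0.
Qed.

Lemma norm_sin_le x : `|sin x| <= `|x|.
Proof.
wlog x0 : x / 0 <= x.
  move=> h; have [/h//|/ltW x0] := leP 0 x.
  by rewrite -normrN -sinN -(normrN x) h// oppr_ge0.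
have [->|xn0] := eqVneq x 0; first by rewrite sin0.
have xp : 0 < x by rewrite lt_neqAle eq_sym xn0.
have [|c _] := @MVT _ (@sin R) (@cos R) 0 x xp (fun y _ => is_derive_sin y).
  by apply: continuous_subspaceT; exact: continuous_sin.
rewrite sin0 !subr0 => ->; rewrite normrM ler_piMl//; exact: cos_max.
Qed.

Lemma norm_subrXX_le (a b : R) n : `|a| <= 1 -> `|b| <= 1 ->
  `|a ^+ n - b ^+ n| <= n%:R * `|a - b|.
Proof.
move=> a1 b1; elim: n => [|n ih]; first by rewrite !expr0 subrr normr0 mul0r.
have -> : a ^+ n.+1 - b ^+ n.+1 = a * (a ^+ n - b ^+ n) + (a - b) * b ^+ n.
  by rewrite !exprS; ring.
rewrite (le_trans (ler_normD _ _))// !normrM -natr1 mulrDl mul1r lerD//.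
  by rewrite (le_trans _ ih)// ler_piMl.
by rewrite ler_piMr// normrX exprn_ile1.
Qed.

(** The Gaussian factor as a limit of trigonometric polynomials: both bases
    differ from 1 by the same amount to first order in the inverse of the
    exponent. *)
Lemma cvg_cos_pow x :
  cos (step n * x) ^+ (n.+1 ^ 2) @[n --> \oo] --> expR (- (x ^+ 2 / 2)).
Proof.
pose b n := expR (- (x ^+ 2 / 2) * step n ^+ 2).
have bE n : b n ^+ (n.+1 ^ 2) = expR (- (x ^+ 2 / 2)).
  rewrite /b -expRM_natr natrX /step; congr expR; field.
  by rewrite addrC natr1.
have c1 : (step n ^+ 2)^-1 * (1 - cos (step n * x)) @[n --> \oo] --> x ^+ 2 / 2.
  have -> : x ^+ 2 / 2 = 2 * (x / 2) ^+ 2 by field.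
  have -> : (fun n => (step n ^+ 2)^-1 * (1 - cos (step n * x))) =
      (fun n => 2 * ((step n)^-1 * sin (step n * (x / 2))) ^+ 2).
    apply/funext => n; have -> : step n * x = step n * (x / 2) *+ 2.
      by rewrite -mulr_natr; field.
    rewrite cos_mulr2n cos2sin2; move: (sin _) => z; field; exact: step_neq0.
  apply: cvgM; first exact: cvg_cst.
  by apply: cvg_sqr; exact: cvg_sin_step.
have c2 : (step n ^+ 2)^-1 * (1 - b n) @[n --> \oo] --> x ^+ 2 / 2.
  have d : is_derive (0 : R) 1 (fun h => - expR (- (x ^+ 2 / 2) * h)) (x ^+ 2 / 2).
    by apply: is_derive_eq; rewrite /GRing.scale/= mulr0 expR0; ring.
  have h0 n : step n ^+ 2 != 0 by rewrite expf_neq0// step_neq0.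
  have h1 : step n ^+ 2 @[n --> \oo] --> 0.
    have -> : 0 = (0 : R) ^+ 2 by rewrite expr0n.
    by apply: cvg_sqr; exact: cvg_step.
  have := cvg_slope d h0 h1; rewrite mulr0 expR0.
  by under eq_fun do rewrite opprK addrC.
have c3 : (step n ^+ 2)^-1 * (b n - cos (step n * x)) @[n --> \oo] --> 0.
  have h : (step n ^+ 2)^-1 * (1 - cos (step n * x)) -
      (step n ^+ 2)^-1 * (1 - b n) @[n --> \oo] --> x ^+ 2 / 2 - x ^+ 2 / 2.
    exact: cvgB.
  by rewrite subrr in h; apply: cvg_eq h => n /=; ring.
have b1 n : `|b n| <= 1.
  rewrite ger0_norm ?expR_ge0// expR_le1 mulNr oppr_le0.
  by rewrite mulr_ge0 ?sqr_ge0// divr_ge0 ?sqr_ge0.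
apply/subr_cvg0; apply: cvg0_le c3 => n.
rewrite -(bE n) distrC (le_trans (norm_subrXX_le _ _ _))// ?cos_max//.
rewrite normrM natrX /step exprVn invrK (ger0_norm (sqr_ge0 _)) distrC.
by rewrite ler_wpM2l ?sqr_ge0.
Unshelve. all: by end_near. Qed.
Lemma cvg_cos_pow_pred x : cos (step m * x) ^+ (m.+1 ^ 2).-1 @[m --> \oo] -->
  expR (- (x ^+ 2 / 2)).
Proof.
apply/subr_cvg0; have h : cos (step m * x) ^+ (m.+1 ^ 2).-1 -
    cos (step m * x) ^+ (m.+1 ^ 2) @[m --> \oo] --> 0.
  have h1 : 1 - cos (step m * x) @[m --> \oo] --> 0.
    have h0 : step m * x @[m --> \oo] --> 0 * x.
      by apply: cvgM; [exact: cvg_step|exact: cvg_cst].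
    have hc : cos (step m * x) @[m --> \oo] --> cos (0 * x).
      exact: cvg_comp _ _ h0 (@continuous_cos R (0 * x)).
    rewrite mul0r cos0 in hc; rewrite -(subrr (1 : R)).
    by apply: cvgB hc; exact: cvg_cst.
  apply: cvg0_le h1 => m.
  have -> : cos (step m * x) ^+ (m.+1 ^ 2) =
      cos (step m * x) * cos (step m * x) ^+ (m.+1 ^ 2).-1.
    by rewrite -exprS prednK// expn_gt0.
  rewrite -[X in `|X - _|]mul1r -mulrBl normrM ler_piMr// normrX exprn_ile1//.
  exact: cos_max.
have h2 : cos (step m * x) ^+ (m.+1 ^ 2) - expR (- (x ^+ 2 / 2)) @[m --> \oo]
    --> 0 by apply/subr_cvg0; exact: cvg_cos_pow.
have h3 : (cos (step m * x) ^+ (m.+1 ^ 2).-1 -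
    cos (step m * x) ^+ (m.+1 ^ 2)) + (cos (step m * x) ^+ (m.+1 ^ 2) -
    expR (- (x ^+ 2 / 2))) @[m --> \oo] --> (0 + 0 : R) by exact: cvgD.
by rewrite addr0 in h3; apply: cvg_eq h3 => m /=; ring.
Qed.

End Sequences.

(** * Linear combinations of a Gaussian vector *)

Section GaussianVector.
Context {d : measure_display} {T : measurableType d} {R : realType}.
Variables (P : probability T R) (n : nat) (Y : 'I_n -> {RV P >-> R}).
Hypothesis gY : centred_gaussian Y.
Implicit Types (a b : 'I_n -> R) (s : R) (f g : T -> R).

Definition lin a (w : T) : R := \sum_i a i * Y i w.
Definition cov (i j : 'I_n) : R := Ex P (fun w => Y i w * Y j w).
Definition bicov a b : R := \sum_i \sum_j a i * b j * cov i j.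

Lemma lin_RV a : exists2 F : {RV P >-> R}, centred_normal F & F =1 lin a.
Proof.
exists (\sum_(i < n) a i *: Y i); first by apply: gY; exists n, id, a.
by move=> w; rewrite mfun_sum; apply: eq_bigr.
Qed.

Lemma mY i : mfun (Y i).
Proof. exact: measurable_funPT. Qed.

Lemma mlin a : mfun (lin a).
Proof. by have [F _ /funext <-] := lin_RV a; exact: measurable_funPT. Qed.

Lemma lin_delta i : lin (fun j => (i == j)%:R) = Y i.
Proof.
apply/funext => w; rewrite /lin (bigD1 i)//= eqxx mul1r big1 ?addr0// => j ji.
by rewrite eq_sym (negbTE ji) mul0r.
Qed.

Lemma lin_comb s t a b w :
  lin (fun i => s * a i + t * b i) w = s * lin a w + t * lin b w.
Proof.
rewrite /lin !mulr_sumr -big_split/=; apply: eq_bigr => i _; ring.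
Qed.

Lemma L1_Y4 i : L1 P (fun w => Y i w ^+ 4).
Proof.
have [F nF FY] := lin_RV (fun j => (i == j)%:R).
rewrite lin_delta in FY; have [h _ _] := centred_normal_moments nF.
by apply: eq_L1 h => w; rewrite FY.
Qed.

(** A common integrable bound for all polynomials of degree at most four. *)
Definition quartic w : R := 1 + \sum_i Y i w ^+ 4.

Lemma pow4_ge0 (x : R) : 0 <= x ^+ 4.
Proof. by rewrite exprn_even_ge0. Qed.

Lemma L1_quartic : L1 P quartic.
Proof. by apply: L1D; [exact: L1_cst|apply: L1_sum => i; exact: L1_Y4]. Qed.

Lemma quartic_ge1 w : 1 <= quartic w.
Proof. by rewrite lerDl sumr_ge0// => i _; exact: pow4_ge0. Qed.

Lemma Y4_le_quartic i w : 1 + Y i w ^+ 4 <= quartic w.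
Proof.
rewrite lerD2l (bigD1 i)//= lerDl sumr_ge0// => j _; exact: pow4_ge0.
Qed.

Lemma norm4_le (x y z t : R) :
  `|x * y * z * t| <= (x ^+ 4 + y ^+ 4 + z ^+ 4 + t ^+ 4) / 4.
Proof.
have amgm (u v : R) : `|u * v| <= (u ^+ 2 + v ^+ 2) / 2.
  have := sqr_ge0 (u - v); have := sqr_ge0 (u + v).
  by rewrite ler_norml => h1 h2; apply/andP; split; nra.
have -> : x * y * z * t = (x * y) * (z * t) by ring.
apply: le_trans (amgm _ _) _.
have h1 := amgm (x ^+ 2) (y ^+ 2); have h2 := amgm (z ^+ 2) (t ^+ 2).
rewrite -!exprMn !ger0_norm ?sqr_ge0// -!exprM in h1 h2.
move: h1 h2; move: ((x * y) ^+ 2) ((z * t) ^+ 2) => u v.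
lra.
Qed.

Lemma YYYY_le i j k l w : `|Y i w * Y j w * Y k w * Y l w| <= quartic w.
Proof.
apply: le_trans (norm4_le _ _ _ _) _; have := quartic_ge1 w.
have := Y4_le_quartic i w; have := Y4_le_quartic j w.
have := Y4_le_quartic k w; have := Y4_le_quartic l w.
move: (Y i w ^+ 4) (Y j w ^+ 4) (Y k w ^+ 4) (Y l w ^+ 4) => x y z t; lra.
Qed.

Lemma YY_le i j w : `|Y i w * Y j w| <= quartic w.
Proof.
have q1 := quartic_ge1 w.
have := norm4_le (Y i w) (Y j w) 1 1; rewrite !mulr1 => /le_trans; apply.
have := Y4_le_quartic i w; have := Y4_le_quartic j w; rewrite !expr1n.
move: (Y i w ^+ 4) (Y j w ^+ 4) => x y; lra.
Qed.

Lemma Y_le i w : `|Y i w| <= quartic w.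
Proof.
have q1 := quartic_ge1 w.
have := norm4_le (Y i w) 1 1 1; rewrite !mulr1 => /le_trans; apply.
have := Y4_le_quartic i w; rewrite !expr1n.
move: (pow4_ge0 (Y i w)); move: (Y i w ^+ 4) => x; lra.
Qed.

Lemma L1_YY i j : L1 P (fun w => Y i w * Y j w).
Proof.
by apply: L1_le L1_quartic (YY_le i j); apply: measurable_funM; exact: mY.
Qed.

Lemma L1_YYYY i j k l : L1 P (fun w => Y i w * Y j w * Y k w * Y l w).
Proof.
apply: L1_le L1_quartic (YYYY_le i j k l).
by do 3?apply: measurable_funM; exact: mY.
Qed.

Lemma linM_le a b : exists A : R, forall w, `|lin a w * lin b w| <= A * quartic w.
Proof.
exists (\sum_i \sum_j `|a i * b j|) => w; rewrite /lin big_distrlr/=.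
rewrite (le_trans (ler_norm_sum _ _ _))// mulr_suml ler_sum// => i _.
rewrite (le_trans (ler_norm_sum _ _ _))// mulr_suml ler_sum// => j _.
by rewrite mulrACA normrM ler_wpM2l// YY_le.
Qed.

Lemma L1_linM a b : L1 P (fun w => lin a w * lin b w).
Proof.
have [A hA] := linM_le a b; apply: L1_le (L1Z A L1_quartic) hA.
by apply: measurable_funM; exact: mlin.
Qed.

Lemma Ex_linM a b : Ex P (fun w => lin a w * lin b w) = bicov a b.
Proof.
rewrite (eq_Ex P (g := fun w => \sum_i \sum_j a i * b j * (Y i w * Y j w))).
  rewrite Ex_sum => [|i]; last by apply: L1_sum => j; exact/L1Z/L1_YY.
  apply: eq_bigr => i _; rewrite Ex_sum => [|j]; last exact/L1Z/L1_YY.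
  by apply: eq_bigr => j _; rewrite ExZ//; exact: L1_YY.
move=> w; rewrite /lin big_distrlr/=; apply: eq_bigr => i _.
by apply: eq_bigr => j _; rewrite mulrACA.
Qed.

Lemma bicovC a b : bicov a b = bicov b a.
Proof. by rewrite -!Ex_linM; apply: eq_Ex => w; rewrite mulrC. Qed.

Lemma bicov_comb s t a b c :
  bicov (fun i => s * a i + t * b i) c = s * bicov a c + t * bicov b c.
Proof.
rewrite -!Ex_linM -!ExZ; [|exact: L1_linM|exact: L1_linM].
rewrite -ExD; [|exact/L1Z/L1_linM|exact/L1Z/L1_linM].
by apply: eq_Ex => w; rewrite lin_comb; ring.
Qed.

Lemma Ex_lin4 a : Ex P (fun w => lin a w ^+ 4) = 3 * bicov a a ^+ 2.
Proof.
have [F nF /funext FY] := lin_RV a; have [_ + _] := centred_normal_moments nF.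
by rewrite FY -Ex_linM.
Qed.

Lemma Ex_lin_sin a :
  Ex P (fun w => lin a w * sin (lin a w)) =
    bicov a a * Ex P (fun w => cos (lin a w)).
Proof.
have [F nF /funext FY] := lin_RV a; have [_ _] := centred_normal_moments nF.
by rewrite FY -Ex_linM.
Qed.

Lemma eq_bicov_cos a b : bicov a a = bicov b b ->
  Ex P (fun w => cos (lin a w)) = Ex P (fun w => cos (lin b w)).
Proof.
have [F nF /funext FY] := lin_RV a; have [G nG /funext GY] := lin_RV b.
by rewrite -!Ex_linM -FY -GY => h; exact: centred_normal_eq_cos.
Qed.

Lemma mcos f : mfun f -> mfun (fun w => cos (f w)).
Proof.
move=> mf; apply: measurableT_comp mf.
by apply: continuous_mfun; exact: continuous_cos.
Qed.

Lemma msin f : mfun f -> mfun (fun w => sin (f w)).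
Proof.
move=> mf; apply: measurableT_comp mf.
by apply: continuous_mfun; exact: continuous_sin.
Qed.

Lemma L1_bounded f : mfun f -> (forall w, `|f w| <= 1) -> L1 P f.
Proof. by move=> mf f1; exact: L1_le (L1_cst P 1) f1. Qed.

Lemma L1_linMsin a b : L1 P (fun w => lin b w * sin (lin a w)).
Proof.
have i := L1_norm (@Ex_norm_le_sqrt _ _ _ P (lin b) (mlin b) (L1_linM b b)).1.
apply: L1_le i _ => [|w].
  by apply: measurable_funM; [|apply: msin]; exact: mlin.
by rewrite normrM ler_piMr// sin_max.
Qed.

(** A trace of the independence of uncorrelated Gaussian variables. The sum
    [lin a + h * lin r] and the difference [lin a - h * lin r] have the same
    variance, hence the same law, so the expectations of their cosines agree and
    the product of sines has mean zero; it is linearized at [h = 0]. *)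
Lemma uncorrelated_sin a r : bicov r a = 0 ->
  Ex P (fun w => lin r w * sin (lin a w)) = 0.
Proof.
move=> ra.
have step0 m : Ex P (fun w => ((step m)^-1 * sin (step m * lin r w)) *
    sin (lin a w)) = 0.
  set h := step m.
  have e : bicov (fun i => 1 * a i + h * r i) (fun i => 1 * a i + h * r i) =
      bicov (fun i => 1 * a i + (- h) * r i) (fun i => 1 * a i + (- h) * r i).
    rewrite !bicov_comb !(bicovC _ (fun i => _ + _)) !bicov_comb ra bicovC ra.
    by ring.
  have := eq_bicov_cos e.
  under eq_Ex do rewrite lin_comb mul1r cosD.
  under [in RHS]eq_Ex do rewrite lin_comb mul1r mulNr cosB.
  have icc : L1 P (fun w => cos (lin a w) * cos (h * lin r w)).
    apply: L1_bounded => [|w].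
      apply: measurable_funM; apply: mcos; first exact: mlin.
      exact: measurable_funM (mlin _).
    by rewrite normrM mulr_ile1 ?cos_max.
  have iss : L1 P (fun w => sin (lin a w) * sin (h * lin r w)).
    apply: L1_bounded => [|w].
      apply: measurable_funM; apply: msin; first exact: mlin.
      exact: measurable_funM (mlin _).
    by rewrite normrM mulr_ile1 ?sin_max.
  rewrite ExB// ExD// => z.
  have z0 : Ex P (fun w => sin (lin a w) * sin (h * lin r w)) = 0 by lra.
  rewrite (eq_Ex P (g := fun w => h^-1 * (sin (lin a w) * sin (h * lin r w)))).
    by rewrite ExZ// z0 mulr0.
  by move=> w; ring.
have ir := L1_norm (@Ex_norm_le_sqrt _ _ _ P (lin r) (mlin r) (L1_linM r r)).1.
have ms m : mfun (fun w => (step m)^-1 * sin (step m * lin r w) * sin (lin a w)).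
  apply: measurable_funM; last exact/msin/mlin.
  by apply: measurable_funM => //; apply: msin; exact: measurable_funM (mlin _).
have [|w|m w|_] := dominated_Ex ms _ _ ir (f := fun w => lin r w * sin (lin a w)).
- by apply: measurable_funM; [|apply: msin]; exact: mlin.
- by apply: cvgM; [exact: cvg_sin_step|exact: cvg_cst].
- rewrite -mulrA normrM normfV mulrC ler_pdivrMr ?normr_gt0 ?step_neq0//.
  rewrite normrM -[leRHS]mulr1 ler_pM ?sin_max//.
  by rewrite (le_trans (norm_sin_le _))// normrM mulrC.
- under eq_fun do rewrite step0.
  by move/(cvg_unique _)/(_ (cvg_cst _)) => ->.
Qed.

Lemma Ex_normM_eq0 f g : mfun f -> mfun g -> L1 P (fun w => f w ^+ 2) ->
  L1 P (fun w => g w ^+ 2) -> Ex P (fun w => g w ^+ 2) = 0 ->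
  Ex P (fun w => `|f w * g w|) = 0.
Proof.
move=> mf mg if2 ig2 g0.
set M := Ex P (fun w => f w ^+ 2); have M0 : 0 <= M.
  by apply: Ex_ge0 => w; exact: sqr_ge0.
have amgm (e x y : R) : 0 < e -> `|x * y| <= e * x ^+ 2 + e^-1 * y ^+ 2.
  move=> e0; rewrite -(ler_pM2l e0).
  have -> : e * (e * x ^+ 2 + e^-1 * y ^+ 2) = (e * x) ^+ 2 + y ^+ 2.
    by field; rewrite gt_eqF.
  move: (sqr_ge0 (e * x - y)) (sqr_ge0 (e * x + y)).
  have -> : e * `|x * y| = `|e * x * y| by rewrite -mulrA [RHS]normrM (gtr0_norm e0).
  rewrite ler_norml; move: (e * x) => z h1 h2; apply/andP.
  by split; nra.
have ifg : L1 P (fun w => `|f w * g w|).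
  apply: L1_norm; apply: L1_le (L1D (L1Z 1 if2) (L1Z 1^-1 ig2)) _.
    exact: measurable_funM.
  by move=> w; exact: amgm.
apply: le_anti; rewrite Ex_ge0// andbT; apply/ler_addgt0Pl => e e0.
have e10 : 0 < e / (M + 1) by rewrite divr_gt0// ltr_wpDl.
have : Ex P (fun w => `|f w * g w|) <= e / (M + 1) * M.
  rewrite -[leRHS]addr0 -[X in _ + X](mulr0 (e / (M + 1))^-1) -g0 -!ExZ//.
  rewrite -ExD; [|exact: L1Z|exact: L1Z].
  apply: le_Ex => //; first by apply: L1D; exact: L1Z.
  by move=> w; exact: amgm.
move=> /le_trans; apply; rewrite addr0 -mulrA ler_piMr ?(ltW e0)//.
by rewrite mulrC ler_pdivrMr ?ltr_wpDl// mul1r lerDl.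
Qed.

(** Integration by parts against a sine: split off the component correlated
    with the argument, for which the statement is one-dimensional. *)
Lemma lin_sin_ibp a b : Ex P (fun w => lin b w * sin (lin a w)) =
  bicov b a * Ex P (fun w => cos (lin a w)).
Proof.
set v := bicov a a; set c := bicov b a.
have [v0|v0] := eqVneq v 0.
  have z : Ex P (fun w => `|lin b w * lin a w|) = 0.
    apply: Ex_normM_eq0; [exact: mlin|exact: mlin|exact: L1_linM|exact: L1_linM|].
    by have := Ex_linM a a; rewrite -/v v0.
  have c0 : c = 0.
    apply/normr0_eq0/le_anti; rewrite normr_ge0 andbT -[leRHS]z /c -Ex_linM.
    by apply: normr_Ex; exact: L1_linM.
  rewrite c0 mul0r; apply/normr0_eq0/le_anti; rewrite normr_ge0 andbT -[leRHS]z.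
  apply: le_trans (normr_Ex (L1_linMsin a b)) _.
  apply: le_Ex; [exact/L1_norm/L1_linMsin|exact/L1_norm/L1_linM|].
  by move=> w; rewrite !normrM ler_wpM2l// norm_sin_le.
have ra : bicov (fun i => v * b i + (- c) * a i) a = 0.
  by rewrite bicov_comb -/v -/c; ring.
have := uncorrelated_sin ra; under eq_Ex do rewrite lin_comb.
rewrite (eq_Ex P (g := fun w => v * (lin b w * sin (lin a w)) +
    - c * (lin a w * sin (lin a w)))); last by move=> w; ring.
rewrite ExD ?ExZ; [|exact: L1_linMsin|exact: L1_linMsin|exact/L1Z/L1_linMsin|
  exact/L1Z/L1_linMsin].
rewrite Ex_lin_sin -/v => h; apply: (mulfI v0).
by move: h; move: (Ex _ _) (Ex _ _) => x y; lra.
Qed.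
End GaussianVector.

(** * Gaussian damping by products of cosines *)

Section GaussianDamping.
Context {d : measure_display} {T : measurableType d} {R : realType}.
Variables (P : probability T R) (n : nat) (Y : 'I_n -> {RV P >-> R}).
Hypothesis gY : centred_gaussian Y.
Implicit Types (a b t : 'I_n -> R) (s : R) (f Q : T -> R) (D : 'I_n -> T -> R).
Notation lin := (lin Y).
Notation cov := (cov Y).
Notation quartic := (quartic Y).

Let mY i : mfun (Y i). Proof. exact: mY. Qed.
Let mlin a : mfun (lin a). Proof. exact: mlin. Qed.
Let quartic1 w : 1 <= quartic w. Proof. exact: quartic_ge1. Qed.
Let Lquartic : L1 P quartic. Proof. exact: L1_quartic. Qed.

Lemma L1_quartic_le f (K : R) : mfun f ->
  (forall w, `|f w| <= K * quartic w) -> L1 P f.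
Proof. by move=> mf fK; exact: L1_le (L1Z K Lquartic) fK. Qed.

(** Integration by parts for the product of [Q] with sines of all frequencies [t];
    [D] stands for the gradient of [Q] in the coordinates of [Y]. Ranging over all
    [t] makes the property stable under multiplication by cosines, and the bounds
    make it stable under pointwise limits. *)
Definition damping Q D : Prop :=
  [/\ mfun Q, (forall k, mfun (D k)), (forall w, `|Q w| <= 1),
    exists K : R, forall k w, `|D k w| <= K * quartic w &
    forall j t, Ex P (fun w => Y j w * sin (lin t w) * Q w) =
      \sum_k cov j k * Ex P (fun w => t k * cos (lin t w) * Q w +
                                      sin (lin t w) * D k w)].

Lemma eq_damping Q Q2 D D2 : Q =1 Q2 -> D =2 D2 -> damping Q D -> damping Q2 D2.
Proof.
by move=> /funext <- DD; have -> : D2 = D by apply/funext => k; apply/funext.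
Qed.

Lemma bicov_delta j t : bicov Y (fun k => (j == k)%:R) t = \sum_k cov j k * t k.
Proof.
rewrite /bicov (bigD1 j)//= [X in _ + X]big1 ?addr0 => [|i ij].
  by apply: eq_bigr => k _; rewrite eqxx mul1r mulrC.
by apply: big1 => k _; rewrite eq_sym (negbTE ij) !mul0r.
Qed.

Lemma damping1 : damping (fun _ => 1) (fun _ _ => 0).
Proof.
split => //.
- by move=> w; rewrite normr1.
- by exists 0 => k w; rewrite normr0 mul0r.
move=> j t; have := lin_sin_ibp gY t (fun k => (j == k)%:R).
rewrite bicov_delta lin_delta.
rewrite -(eq_Ex P (f := fun w => Y j w * sin (lin t w) * 1)); last first.
  by move=> w; rewrite mulr1.
move=> ->; rewrite mulr_suml; apply: eq_bigr => k _.
rewrite -mulrA; congr (_ * _); rewrite -ExZ.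
  by apply: eq_Ex => w; ring.
apply: L1_bounded; first exact: mcos.
by move=> w; exact: cos_max.
Qed.

Let L1_YsinQ Q D j t : damping Q D -> L1 P (fun w => Y j w * sin (lin t w) * Q w).
Proof.
move=> [mQ mD Q1 _ _]; apply: (@L1_quartic_le _ 1).
  by apply: measurable_funM => //; apply: measurable_funM => //; exact: msin.
move=> w; rewrite mul1r !normrM (le_trans _ (Y_le Y j w))//.
by rewrite -mulrA ler_piMr// mulr_ile1// sin_max.
Qed.

Let L1_grad Q D t k : damping Q D ->
  L1 P (fun w => t k * cos (lin t w) * Q w + sin (lin t w) * D k w).
Proof.
move=> [mQ mD Q1 [K hK] _]; apply: (@L1_quartic_le _ (`|t k| + K)).
  apply: measurable_funD; apply: measurable_funM => //; last exact: msin.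
  by apply: measurable_funM => //; exact: mcos.
move=> w; rewrite (le_trans (ler_normD _ _))// mulrDl lerD//.
  rewrite !normrM -mulrA ler_wpM2l// (le_trans _ (quartic1 w))//.
  by rewrite mulr_ile1// cos_max.
by rewrite normrM (le_trans _ (hK k w))// ler_piMl// sin_max.
Qed.

(** Product-to-sum formulas reduce a cosine factor to the two shifted
    frequencies. *)
Lemma damping_cos a Q D : damping Q D ->
  damping (fun w => cos (lin a w) * Q w)
    (fun k w => - a k * sin (lin a w) * Q w + cos (lin a w) * D k w).
Proof.
move=> dQ; have [mQ mD Q1 [K hK] ibp] := dQ.
split.
- by apply: measurable_funM => //; exact: mcos.
- move=> k; apply: measurable_funD; apply: measurable_funM => //.
    by apply: measurable_funM => //; exact: msin.
  exact: mcos.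
- by move=> w; rewrite normrM mulr_ile1// cos_max.
- exists (\sum_k `|a k| + K) => k w.
  rewrite (le_trans (ler_normD _ _))// mulrDl lerD//.
    rewrite !normrM normrN -mulrA (le_trans (ler_piMr _ _))//.
      by rewrite mulr_ile1// sin_max.
    rewrite (le_trans (ler_peMr _ (quartic1 w)))// ler_wpM2r//.
      by rewrite (le_trans _ (quartic1 w)).
    by rewrite (bigD1 k)//= lerDl sumr_ge0.
  by rewrite normrM (le_trans _ (hK k w))// ler_piMl// cos_max.
move=> j t.
pose tp := fun i => 1 * t i + 1 * a i; pose tm := fun i => 1 * t i + (- 1) * a i.
have lp w : lin tp w = lin t w + lin a w by rewrite lin_comb !mul1r.
have lm w : lin tm w = lin t w - lin a w by rewrite lin_comb mul1r mulN1r.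
rewrite (eq_Ex P (g := fun w => 2^-1 * (Y j w * sin (lin tp w) * Q w +
  Y j w * sin (lin tm w) * Q w))); last first.
  by move=> w; rewrite lp lm sinD sinB; field.
have ip := L1_YsinQ j tp dQ; have im := L1_YsinQ j tm dQ.
rewrite ExZ; last exact: L1D.
rewrite ExD// !ibp -big_split/= mulr_sumr; apply: eq_bigr => k _.
rewrite -mulrDr mulrCA; congr (_ * _).
have gp := L1_grad tp k dQ; have gm := L1_grad tm k dQ.
rewrite -ExD// -ExZ; last exact: L1D.
by apply: eq_Ex => w; rewrite lp lm /tp /tm sinD sinB cosD cosB; field.
Qed.

Lemma damping_cosX a N Q D : damping Q D ->
  damping (fun w => cos (lin a w) ^+ N * Q w)
    (fun k w => - (N%:R * a k * sin (lin a w)) * cos (lin a w) ^+ N.-1 * Q w +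
                cos (lin a w) ^+ N * D k w).
Proof.
move=> dQ; elim: N => [|N ih].
  apply: eq_damping dQ => [w|k w]; first by rewrite expr0 mul1r.
  by rewrite !mul0r oppr0 !mul0r add0r expr0 mul1r.
apply: eq_damping (damping_cos a ih) => [w|k w]; first by rewrite exprS mulrA.
case: N {ih} => [|N]; first by rewrite /= !expr0 expr1; ring.
by rewrite /= !exprS -!natr1; ring.
Qed.

(** Gaussian damping in one coordinate is the limit of powers of a cosine of
    ever lower frequency. *)
Lemma damping_expR i s Q D : 0 <= s -> damping Q D ->
  damping (fun w => expR (- (s * Y i w ^+ 2)) * Q w)
    (fun k w => - (2 * s * (i == k)%:R * Y i w) * expR (- (s * Y i w ^+ 2)) * Q w
                + expR (- (s * Y i w ^+ 2)) * D k w).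
Proof.
move=> s0 dQ; have [mQ mD Q1 [K hK] ibp] := dQ.
have mE : mfun (fun w => expR (- (s * Y i w ^+ 2))).
  apply: measurableT_comp => //; apply: measurable_funN => //.
  by apply: measurable_funM => //; exact: measurable_funX.
have E1 w : `|expR (- (s * Y i w ^+ 2))| <= 1.
  by rewrite ger0_norm ?expR_ge0// expR_le1 oppr_le0 mulr_ge0// sqr_ge0.
have mD' k : mfun (fun w => - (2 * s * (i == k)%:R * Y i w) *
    expR (- (s * Y i w ^+ 2)) * Q w + expR (- (s * Y i w ^+ 2)) * D k w).
  apply: measurable_funD; apply: measurable_funM => //.
  by apply: measurable_funM => //; apply: measurable_funN => //;
     exact: measurable_funM.
pose c := Num.sqrt (2 * s).
have cc : c * c = 2 * s by rewrite -expr2 sqr_sqrtr// mulr_ge0.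
pose a m := fun k => step m * c * (i == k)%:R : R.
have la m w : lin (a m) w = step m * (c * Y i w).
  rewrite -[LHS]/(\sum_k a m k * Y k w) (bigD1 i)//= big1 ?addr0 => [|k ki].
    by rewrite /a eqxx mulr1 mulrA.
  by rewrite /a eq_sym (negbTE ki) mulr0 mul0r.
pose q m w := cos (step m * (c * Y i w)) ^+ (m.+1 ^ 2) * Q w.
pose q' m k w := - (c * (i == k)%:R *
  ((step m)^-1 * sin (step m * (c * Y i w)))) *
  cos (step m * (c * Y i w)) ^+ (m.+1 ^ 2).-1 * Q w +
  cos (step m * (c * Y i w)) ^+ (m.+1 ^ 2) * D k w.
have dm m : damping (q m) (q' m).
  apply: eq_damping (damping_cosX (a m) (m.+1 ^ 2) dQ) => [w|k w].
    by rewrite la.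
  rewrite la /q' /a natrX /step.
  by congr (- _ * _ * _ + _); field; rewrite addrC natr1.
have q'b m k w : `|q' m k w| <= (2 * s + K) * quartic w.
  rewrite /q' (le_trans (ler_normD _ _))// mulrDl lerD//; last first.
    by rewrite normrM (le_trans _ (hK k w))// ler_piMl// normrX exprn_ile1// cos_max.
  rewrite normrM (le_trans (ler_piMr _ (Q1 w)))// normrM.
  rewrite (le_trans (ler_piMr _ _))// ?normrX ?exprn_ile1// ?cos_max//.
  rewrite normrN -cc normrM -mulrA ger0_norm; last by rewrite mulr_ge0 ?sqrtr_ge0.
  apply: ler_pM => //; first by rewrite mulr_ge0 ?sqrtr_ge0.
    by rewrite -[leRHS]mulr1 ler_wpM2l ?sqrtr_ge0//; case: eqP.
  rewrite normrM normfV mulrC ler_pdivrMr ?normr_gt0 ?step_neq0//.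
  rewrite (le_trans (norm_sin_le _))// normrM mulrC ler_wpM2r//.
  by rewrite normrM ger0_norm ?sqrtr_ge0// ler_wpM2l ?sqrtr_ge0// Y_le.
have sc w : c * Y i w * (c * Y i w) = 2 * s * Y i w ^+ 2.
  by rewrite mulrACA cc expr2.
have eE w : expR (- ((c * Y i w) ^+ 2 / 2)) = expR (- (s * Y i w ^+ 2)).
  by rewrite expr2 sc; congr expR; field.
have cq w : q m w @[m --> \oo] --> expR (- (s * Y i w ^+ 2)) * Q w.
  by apply: cvgM; [rewrite -eE; exact: cvg_cos_pow|exact: cvg_cst].
have cq' k w : q' m k w @[m --> \oo] --> - (2 * s * (i == k)%:R * Y i w) *
    expR (- (s * Y i w ^+ 2)) * Q w + expR (- (s * Y i w ^+ 2)) * D k w.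
  apply: cvgD; (apply: cvgM; last exact: cvg_cst); last first.
    by rewrite -eE; exact: cvg_cos_pow.
  apply: cvgM; last by rewrite -eE; exact: cvg_cos_pow_pred.
  apply: cvgN; rewrite -cc.
  have -> : c * c * (i == k)%:R * Y i w = c * (i == k)%:R * (c * Y i w) by ring.
  by apply: cvgM; [exact: cvg_cst|exact: cvg_sin_step].
split => //.
- exact: measurable_funM.
- by move=> w; rewrite normrM mulr_ile1.
- exists (2 * s + K) => k w.
  have c1 : `|q' m k w| @[m --> \oo] --> `|- (2 * s * (i == k)%:R * Y i w) *
    expR (- (s * Y i w ^+ 2)) * Q w + expR (- (s * Y i w ^+ 2)) * D k w|.
    by apply: cvg_norm; exact: cq'.
  by apply: (cvgr_to_le c1); apply: nearW => m; exact: q'b.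
move=> j t.
have msl : mfun (fun w => sin (lin t w)) by exact: msin.
have mcl : mfun (fun w => cos (lin t w)) by exact: mcos.
have mqm m : mfun (q m) by have [] := dm m.
have qm1 m w : `|q m w| <= 1 by have [_ _ + _ _] := dm m; exact.
have mqm' m k : mfun (q' m k) by have [_ + _ _ _] := dm m; exact.
have L : Ex P (fun w => Y j w * sin (lin t w) * q m w) @[m --> \oo] -->
    Ex P (fun w => Y j w * sin (lin t w) * (expR (- (s * Y i w ^+ 2)) * Q w)).
  apply: (dominated_Ex _ _ _ Lquartic _).2 => [m||w|m w].
  - by apply: measurable_funM; [exact: measurable_funM|exact: mqm].
  - by apply: measurable_funM; exact: measurable_funM.
  - by apply: cvgM; [exact: cvg_cst|exact: cq].
  - rewrite 2!normrM (le_trans _ (Y_le Y j w))//.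
    by rewrite -mulrA ler_piMr// mulr_ile1// sin_max.
have Rk k : Ex P (fun w => t k * cos (lin t w) * q m w +
    sin (lin t w) * q' m k w) @[m --> \oo] -->
    Ex P (fun w => t k * cos (lin t w) * (expR (- (s * Y i w ^+ 2)) * Q w) +
    sin (lin t w) * (- (2 * s * (i == k)%:R * Y i w) *
    expR (- (s * Y i w ^+ 2)) * Q w + expR (- (s * Y i w ^+ 2)) * D k w)).
  apply: (dominated_Ex _ _ _ (L1Z (`|t k| + (2 * s + K)) Lquartic) _).2.
  - move=> m; apply: measurable_funD.
      by apply: measurable_funM; [exact: measurable_funM|exact: mqm].
    by apply: measurable_funM; [exact: msl|exact: mqm'].
  - apply: measurable_funD.
      by apply: measurable_funM; exact: measurable_funM.
    by apply: measurable_funM; [exact: msl|exact: mD'].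
  - move=> w; apply: cvgD; apply: cvgM; [exact: cvg_cst|exact: cq|
      exact: cvg_cst|exact: cq'].
  - move=> m w; rewrite (le_trans (ler_normD _ _))// mulrDl lerD//.
      rewrite 2!normrM -mulrA ler_wpM2l// (le_trans _ (quartic1 w))//.
      by rewrite mulr_ile1// cos_max.
    by rewrite normrM (le_trans _ (q'b m k w))// ler_piMl// sin_max.
apply: (cvg_unique _ L) => //.
have -> : (fun m => Ex P (fun w => Y j w * sin (lin t w) * q m w)) =
    (fun m => \sum_k cov j k * Ex P (fun w => t k * cos (lin t w) * q m w +
    sin (lin t w) * q' m k w)).
  by apply/funext => m; have [_ _ _ _ ->] := dm m.
by apply: cvg_sum => k; apply: cvgM; [exact: cvg_cst|exact: Rk].
Qed.

Lemma damping_exp_sum s (r : seq 'I_n) : 0 <= s ->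
  damping (fun w => expR (- (s * \sum_(i <- r) Y i w ^+ 2)))
    (fun k w => - (2 * s * (count_mem k r)%:R * Y k w) *
                expR (- (s * \sum_(i <- r) Y i w ^+ 2))).
Proof.
move=> s0; elim: r => [|i r ih].
  apply: eq_damping damping1 => [w|k w]; first by rewrite big_nil mulr0 oppr0 expR0.
  by rewrite /= mulr0 mul0r oppr0 mul0r.
have E w : expR (- (s * \sum_(j <- i :: r) Y j w ^+ 2)) =
    expR (- (s * Y i w ^+ 2)) * expR (- (s * \sum_(j <- r) Y j w ^+ 2)).
  by rewrite -expRD big_cons mulrDr opprD.
apply: eq_damping (damping_expR i s0 ih) => [w|k w]; first by rewrite E.
rewrite E /= natrD; case: eqP => [->|_]; rewrite /= ?mulr1n ?mulr0n; first by ring.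
by ring.
Qed.

Definition sqnorm w : R := \sum_i Y i w ^+ 2.

(** The factor [Y l] is the limit of [sin (step m * Y l) / step m], to which
    [damping] applies. *)
Lemma expR_sqnorm_ibp s j l : 0 <= s ->
  let F w := expR (- (s * sqnorm w)) in
  Ex P (fun w => Y j w * Y l w * F w) =
    cov j l * Ex P F - 2 * s * \sum_k cov j k * Ex P (fun w => Y l w * Y k w * F w).
Proof.
move=> s0 F; have := damping_exp_sum (index_enum 'I_n) s0.
rewrite -/F; set D := (fun k w => _) => -[mF mD F1 _ ibp].
have DE k w : D k w = - (2 * s * Y k w) * F w.
  by rewrite /D count_uniq_mem ?index_enum_uniq// mem_index_enum mulr1.
have LF : L1 P F by exact: L1_bounded.
have LYYF (u v : 'I_n) : L1 P (fun w => Y u w * Y v w * F w).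
  apply: (@L1_quartic_le _ 1) => [|w].
    by apply: measurable_funM => //; exact: measurable_funM.
  by rewrite mul1r normrM (le_trans _ (YY_le Y u v w))// ler_piMr.
pose t m := fun i => step m * (l == i)%:R : R.
have lt m w : lin (t m) w = step m * Y l w.
  have := congr1 (fun f => step m * f w) (lin_delta Y l); rewrite /= => <-.
  rewrite -[LHS]/(\sum_i t m i * Y i w) -[lin _ w]/(\sum_i (l == i)%:R * Y i w).
  by rewrite mulr_sumr; apply: eq_bigr => i _; rewrite mulrA.
pose S m w := (step m)^-1 * sin (step m * Y l w).
have Sb m w : `|S m w| <= `|Y l w|.
  rewrite /S normrM normfV mulrC ler_pdivrMr ?normr_gt0 ?step_neq0//.
  by rewrite (le_trans (norm_sin_le _))// normrM mulrC.
have cS w : S m w @[m --> \oo] --> Y l w by exact: cvg_sin_step.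
have mS m : mfun (S m).
  by apply: measurable_funM => //; apply: msin; exact: measurable_funM.
have mC m : mfun (fun w => cos (step m * Y l w)).
  by apply: mcos; exact: measurable_funM.
have idm m : Ex P (fun w => Y j w * S m w * F w) = \sum_k cov j k *
    Ex P (fun w => (l == k)%:R * cos (step m * Y l w) * F w + S m w * D k w).
  have := ibp j (t m); under eq_Ex do rewrite lt.
  under eq_bigr => k _ do under eq_Ex do rewrite lt.
  move=> /(congr1 (fun x => (step m)^-1 * x)).
  rewrite -ExZ; last first.
    apply: (@L1_quartic_le _ 1) => [|w].
      by do 2?apply: measurable_funM => //; apply: msin; exact: measurable_funM.
    rewrite mul1r 2!normrM (le_trans _ (Y_le Y j w))//.
    by rewrite -mulrA ler_piMr// mulr_ile1// sin_max.
  rewrite (eq_Ex P (g := fun w => Y j w * S m w * F w)); last first.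
    by move=> w; rewrite /S; ring.
  move=> ->; rewrite mulr_sumr; apply: eq_bigr => k _.
  rewrite mulrCA; congr (_ * _); rewrite -ExZ; last first.
    apply: (@L1_quartic_le _ (`|t m k| + 2 * s)) => [|w].
      apply: measurable_funD.
        apply: measurable_funM; last exact: mF.
        by apply: measurable_funM; [exact: measurable_cst|exact: mC].
      apply: measurable_funM; last exact: mD.
      by apply: msin; exact: measurable_funM.
    rewrite (le_trans (ler_normD _ _))// mulrDl lerD//.
      rewrite 2!normrM -mulrA ler_wpM2l// (le_trans _ (quartic1 w))//.
      by rewrite mulr_ile1// cos_max.
    rewrite normrM (le_trans (ler_piMl _ (sin_max _)))// DE normrM.
    rewrite (le_trans (ler_piMr _ (F1 w)))// normrN normrM.
    by rewrite ger0_norm ?mulr_ge0// ler_wpM2l ?mulr_ge0// Y_le.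
  by apply: eq_Ex => w; rewrite /t /S; field; exact: step_neq0.
have L : Ex P (fun w => Y j w * S m w * F w) @[m --> \oo] -->
    Ex P (fun w => Y j w * Y l w * F w).
  apply: (dominated_Ex _ _ _ Lquartic _).2 => [m||w|m w].
  - by apply: measurable_funM => //; exact: measurable_funM.
  - by apply: measurable_funM => //; exact: measurable_funM.
  - by apply: cvgM; [apply: cvgM; [exact: cvg_cst|exact: cS]|exact: cvg_cst].
  - rewrite normrM (le_trans (ler_piMr _ (F1 w)))//.
    by rewrite (le_trans _ (YY_le Y j l w))// !(normrM (Y j w)) ler_wpM2l.
have Rk k : Ex P (fun w => (l == k)%:R * cos (step m * Y l w) * F w +
    S m w * D k w) @[m --> \oo] -->
    Ex P (fun w => (l == k)%:R * F w + Y l w * D k w).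
  apply: (dominated_Ex _ _ _ (L1Z (1 + 2 * s) Lquartic) _).2.
  - move=> m; apply: measurable_funD.
      apply: measurable_funM; last exact: mF.
      by apply: measurable_funM; [exact: measurable_cst|exact: mC].
    by apply: measurable_funM; [exact: mS|exact: mD].
  - apply: measurable_funD.
      by apply: measurable_funM; [exact: measurable_cst|exact: mF].
    by apply: measurable_funM; [exact: mY|exact: mD].
  - move=> w; apply: cvgD; last by apply: cvgM; [exact: cS|exact: cvg_cst].
    apply: cvgM; last exact: cvg_cst.
    rewrite -[X in _ --> X]mulr1; apply: cvgM; first exact: cvg_cst.
    have h0 : step m * Y l w @[m --> \oo] --> 0 * Y l w.
      by apply: cvgM; [exact: cvg_step|exact: cvg_cst].
    rewrite -(@cos0 R) -(mul0r (Y l w)).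
    exact: cvg_comp _ _ h0 (@continuous_cos R (0 * Y l w)).
  - move=> m w; rewrite (le_trans (ler_normD _ _))// mulrDl lerD//.
      rewrite mul1r 2!normrM (le_trans _ (quartic1 w))//.
      by rewrite !mulr_ile1 ?cos_max//; case: eqP; rewrite ?normr1 ?normr0.
    rewrite DE mulrA normrM (le_trans (ler_piMr _ (F1 w)))//.
    rewrite (normrM (S m w)) normrN (normrM (2 * s)).
    rewrite (ger0_norm (_ : 0 <= 2 * s)) ?mulr_ge0//.
    rewrite mulrCA ler_wpM2l ?mulr_ge0//.
    by rewrite (le_trans _ (YY_le Y l k w))// (normrM (Y l w)) ler_wpM2r.
rewrite (cvg_unique _ L (_ : _ --> \sum_k cov j k *
    Ex P (fun w => (l == k)%:R * F w + Y l w * D k w))) //; last first.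
  under eq_fun do rewrite idm.
  by apply: cvg_sum => k; apply: cvgM; [exact: cvg_cst|exact: Rk].
transitivity (\sum_k (cov j k * (l == k)%:R * Ex P F +
    - (2 * s) * (cov j k * Ex P (fun w => Y l w * Y k w * F w)))).
  apply: eq_bigr => k _.
  have -> : (fun w => (l == k)%:R * F w + Y l w * D k w) =
      (fun w => (l == k)%:R * F w + (- (2 * s)) * (Y l w * Y k w * F w)).
    by apply/funext => w; rewrite DE; ring.
  by rewrite ExD ?ExZ//; [ring|exact: L1Z|exact: L1Z].
rewrite big_split/= -mulr_sumr mulNr; congr (_ - _).
rewrite -mulr_suml (bigD1 l)//= eqxx mulr1 big1 ?addr0// => k kl.
by rewrite eq_sym (negbTE kl) mulr0.
Qed.

End GaussianDamping.

(** * Bernstein polynomials *)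

Section Bernstein.
Context {R : realType}.
Implicit Types (phi psi : nat -> R) (q : R -> R) (u M : R).

(** The expectation of [phi] under the binomial law, as a polynomial in the
    success probability; conditioning on the first trial replaces the closed
    formula with binomial coefficients. *)
Fixpoint bernstein N phi : {poly R} :=
  if N is N'.+1 then 'X * bernstein N' (fun k => phi k.+1) +
                     (1 - 'X) * bernstein N' phi
  else (phi 0%N)%:P.

Lemma bernsteinS N phi u : (bernstein N.+1 phi).[u] =
  u * (bernstein N (fun k => phi k.+1)).[u] + (1 - u) * (bernstein N phi).[u].
Proof. by rewrite /= !hornerE. Qed.

Lemma bernstein_at0 N phi : (bernstein N phi).[0] = phi 0%N.
Proof.
elim: N phi => [|N ih] phi; first by rewrite /= hornerC.
by rewrite bernsteinS mul0r add0r subr0 mul1r ih.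
Qed.

Lemma bernstein_le N phi psi u : 0 <= u <= 1 -> (forall k, phi k <= psi k) ->
  (bernstein N phi).[u] <= (bernstein N psi).[u].
Proof.
move=> /andP[u0 u1]; elim: N phi psi => [|N ih] phi psi h.
  by rewrite /= !hornerC.
by rewrite !bernsteinS lerD// ler_wpM2l ?ih// subr_ge0.
Qed.

Lemma bernstein_affine N a b phi u :
  (bernstein N (fun k => a + b * phi k)).[u] = a + b * (bernstein N phi).[u].
Proof.
elim: N phi => [|N ih] phi; first by rewrite /= !hornerC.
by rewrite !bernsteinS !ih; ring.
Qed.

Lemma bernstein_variance N a u :
  (bernstein N (fun k => (k%:R + a - N%:R * u) ^+ 2)).[u] =
  N%:R * u * (1 - u) + a ^+ 2.
Proof.
elim: N a => [|N ih] a.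
  by rewrite /= hornerC add0r mul0r subr0 !mul0r add0r.
rewrite bernsteinS.
have -> : (fun k => (k.+1%:R + a - N.+1%:R * u) ^+ 2) =
    (fun k => (k%:R + (1 + a - u) - N%:R * u) ^+ 2).
  by apply/funext => k; rewrite -!natr1; ring.
have -> : (fun k => (k%:R + a - N.+1%:R * u) ^+ 2) =
    (fun k => (k%:R + (a - u) - N%:R * u) ^+ 2).
  by apply/funext => k; rewrite -!natr1; ring.
by rewrite !ih -natr1; ring.
Qed.

Definition bernstein_of q N := bernstein N.+1 (fun k => q (k%:R / N.+1%:R)).

Lemma bernstein_of_bound q M u N : (forall x, `|q x| <= M) -> 0 <= u <= 1 ->
  `|(bernstein_of q N).[u]| <= M.
Proof.
move=> qM u01; have cst c : c = (bernstein N.+1 (fun _ => c + 0 * c)).[u].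
  by rewrite (bernstein_affine _ _ _ (fun _ => c)) mul0r addr0.
rewrite ler_norml /bernstein_of; apply/andP; split;
    [rewrite [- M]cst|rewrite [leRHS]cst]; apply: bernstein_le => // k;
  by have := qM (k%:R / N.+1%:R); rewrite mul0r addr0 ler_norml => /andP[].
Qed.

(** Chebyshev's argument: near [u] use continuity, far from [u] use that the
    squared relative deviation is at least one. *)
Lemma bernstein_of_cvg q M u : (forall x, `|q x| <= M) -> 0 <= u <= 1 ->
  {for u, continuous q} -> (bernstein_of q N).[u] @[N --> \oo] --> q u.
Proof.
move=> qM u01 cq; have M0 : 0 <= M by exact: le_trans (qM 0).
apply/cvgrPdist_le => e e0.
have e20 : 0 < e / 2 by rewrite divr_gt0.
have /cvgrPdist_le/(_ _ e20)[dl /= dl0 hd] := cq.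
set b := 2 * M / dl ^+ 2.
have b0 : 0 <= b by rewrite divr_ge0 ?sqr_ge0// mulr_ge0.
have near_far x : `|q x - q u| <= e / 2 + b * (x - u) ^+ 2.
  have [h|h] := ltP `|u - x| dl.
    have := hd x h; rewrite distrC => /le_trans; apply.
    by rewrite lerDl mulr_ge0// sqr_ge0.
  apply: (@le_trans _ _ (2 * M)).
    by rewrite (le_trans (ler_normB _ _))// mulr2n mulrDl mul1r lerD.
  have : 1 <= (x - u) ^+ 2 / dl ^+ 2.
    rewrite ler_pdivlMr ?exprn_gt0// mul1r -(ger0_norm (sqr_ge0 (x - u))) normrX.
    by rewrite ler_pXn2r ?nnegrE ?(ltW dl0)// distrC.
  move=> h1; have -> : b * (x - u) ^+ 2 = 2 * M * ((x - u) ^+ 2 / dl ^+ 2).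
    by rewrite /b; ring.
  by rewrite (le_trans (ler_peMr _ h1)) ?mulr_ge0// lerDr ltW.
have bnd N : `|q u - (bernstein_of q N).[u]| <= e / 2 + b / N.+1%:R.
  have sgn (c : R) : (forall x, c * (q x - q u) <= `|q x - q u|) ->
      c * ((bernstein_of q N).[u] - q u) <= e / 2 + b / N.+1%:R.
    move=> hc.
    have -> : c * ((bernstein_of q N).[u] - q u) =
        (bernstein N.+1 (fun k => - (c * q u) + c * q (k%:R / N.+1%:R))).[u].
      rewrite (bernstein_affine _ _ _ (fun k => q (k%:R / N.+1%:R))).
      by rewrite /bernstein_of; ring.
    apply: (@le_trans _ _ (bernstein N.+1 (fun k => e / 2 + b / N.+1%:R ^+ 2 *
        (k%:R + 0 - N.+1%:R * u) ^+ 2)).[u]).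
      apply: bernstein_le => // k; set x := k%:R / _.
      have -> : - (c * q u) + c * q x = c * (q x - q u) by ring.
      apply: le_trans (hc x) _; apply: le_trans (near_far x) _.
      rewrite lerD2l le_eqVlt; apply/orP; left; apply/eqP; rewrite /x; field.
      by rewrite addrC natr1.
    rewrite (bernstein_affine _ _ _ (fun k => (k%:R + 0 - N.+1%:R * u) ^+ 2)).
    rewrite bernstein_variance expr0n addr0 lerD2l.
    have -> : b / N.+1%:R ^+ 2 * (N.+1%:R * u * (1 - u)) = b / N.+1%:R * (u * (1 - u)).
      by field; rewrite addrC natr1.
    move/andP : u01 => [u0 u1].
    apply: ler_piMr; first exact: divr_ge0.
    by apply: mulr_ile1; rewrite ?subr_ge0// gerBl.
  rewrite ler_norml; apply/andP; split.
    have := sgn 1; rewrite lerNl opprB mul1r; apply => x.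
    by rewrite mul1r ler_norm.
  have := sgn (- 1); rewrite mulN1r opprB; apply => x.
  by rewrite mulN1r -normrN ler_norm.
near=> N; apply: le_trans (bnd N) _; rewrite [leRHS]splitr lerD2l.
rewrite ler_pdivrMr// mulrC -ler_pdivrMr//.
rewrite (le_trans (_ : _ <= N%:R)) ?ler_nat//.
by near: N; exact: nbhs_infty_ger.
Unshelve. all: by end_near. Qed.

End Bernstein.

(** * From exponentials to smooth test functions *)

Section ExponentialTestFunctions.
Context {R : realType}.
Implicit Types (p : {poly R}) (x y a M : R) (f g : R -> R).
Notation mu := (@lebesgue_measure R).

(** A primitive of [fun x => p.[expR (- x)]]; the division by [0] voids the term of
    index 0. *)
Definition exp_primitive a p x : R :=
  a + \sum_(i < size p) p`_i / i%:R * (1 - expR (- (i%:R * x))).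

Lemma horner_expRN p x :
  p.[expR (- x)] = \sum_(i < size p) p`_i * expR (- (i%:R * x)).
Proof.
rewrite horner_coef; apply: eq_bigr => i _.
by rewrite -expRM_natl mulrN.
Qed.

(** The constant term must vanish: its primitive is not a combination of
    exponentials. *)
Lemma is_derive_exp_primitive a p x : p.[0] = 0 ->
  is_derive x 1 (exp_primitive a p) p.[expR (- x)].
Proof.
rewrite horner_coef0 => p0; rewrite horner_expRN.
have -> : exp_primitive a p = (fun y => a + \sum_(i < size p)
    (fun y => p`_i / i%:R * (1 - expR (- (i%:R * y)))) y) by [].
have d (i : 'I_(size p)) : is_derive x 1
    (fun y => p`_i / i%:R * (1 - expR (- (i%:R * y))))
    (p`_i * expR (- (i%:R * x))).
  apply: is_derive_eq; rewrite /GRing.scale/= ?mulr1 ?sub0r.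
  case: (nat_of_ord i) => [|k]; first by rewrite p0; ring.
  by field; rewrite addrC natr1.
have h : is_derive x 1 (\sum_(i < size p)
    (fun y => p`_i / i%:R * (1 - expR (- (i%:R * y)))))
    (\sum_(i < size p) p`_i * expR (- (i%:R * x))) by exact: is_derive_sum.
have -> : (fun y => a + \sum_(i < size p)
    (fun y => p`_i / i%:R * (1 - expR (- (i%:R * y)))) y) =
    cst a + \sum_(i < size p) (fun y => p`_i / i%:R * (1 - expR (- (i%:R * y)))).
  by apply/funext => y; rewrite /= fct_sumE.
by apply: is_derive_eq; rewrite add0r.
Qed.

Lemma exp_primitive0 a p : exp_primitive a p 0 = a.
Proof.
rewrite /exp_primitive big1 ?addr0// => i _.
by rewrite mulr0 oppr0 expR0 subrr mulr0.
Qed.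

Lemma norm_le_of_derive f g M x : (forall y, is_derive y 1 f (g y)) ->
  (forall y, 0 <= y -> `|g y| <= M) -> 0 <= x -> `|f x| <= `|f 0| + M * x.
Proof.
move=> df gM; rewrite le_eqVlt => /predU1P[<-|x0].
  by rewrite mulr0 addr0.
have [|c + e] := MVT x0 (fun y _ => df y).
  by apply: continuous_subspaceT; exact: is_derive_continuous df.
rewrite in_itv/= => /andP[c0 _]; rewrite subr0 in e.
rewrite -[f x](subrK (f 0)) e (le_trans (ler_normD _ _))// addrC lerD2l.
rewrite normrM (gtr0_norm x0); apply: ler_wpM2r; first exact: ltW.
by apply: gM; exact: ltW.
Qed.

(** The fundamental theorem of calculus turns bounded pointwise convergence of the
    derivatives into convergence of the functions. *)
Lemma cvg_of_derivative (f_ g_ : nat -> R -> R) f g M x :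
  (forall n y, is_derive y 1 (f_ n) (g_ n y)) ->
  (forall y, is_derive y 1 f (g y)) ->
  (forall n, continuous (g_ n)) -> continuous g ->
  (forall n, f_ n 0 = f 0) ->
  (forall n y, 0 <= y -> `|g_ n y| <= M) ->
  (forall y, 0 <= y -> g_ n y @[n --> \oo] --> g y) ->
  0 <= x -> f_ n x @[n --> \oo] --> f x.
Proof.
move=> df_ df cg_ cg f0 gM gg; rewrite le_eqVlt => /predU1P[<-|x0].
  by under eq_fun do rewrite f0; exact: cvg_cst.
have FTC (F G : R -> R) : (forall y, is_derive y 1 F (G y)) -> continuous G ->
    F x = F 0 + Ex mu (G \_ `[0, x]).
  move=> dF cG; rewrite /Ex -Rintegral_mkcond /Rintegral.
  rewrite (@continuous_FTC2 _ G F)//=; first by ring.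
  - exact: continuous_subspaceT.
  - have cF := is_derive_continuous dF; split => [y _||].
    + by have [] := dF y.
    + by apply: cvg_at_right_filter; exact: cF.
    + by apply: cvg_at_left_filter; exact: cF.
  - by move=> y _; rewrite derive1E; apply: derive_val.
rewrite (FTC f g)//; under eq_fun do rewrite (FTC _ _ (df_ _))// f0.
apply: cvgD; first exact: cvg_cst.
have mp (G : R -> R) : continuous G -> mfun (G \_ `[0, x]).
  move=> cG; apply/measurable_restrict => //; rewrite setTI.
  by apply: measurable_funTS; exact: continuous_mfun.
apply: (@dominated_Ex _ _ _ mu _ _ (fun y => M * \1_`[0, x] y) _ _ _ _ _).2.
- by move=> n; exact: mp.
- exact: mp.
- move=> y; rewrite patchE; under eq_fun do rewrite patchE.
  case: ifPn => [/set_mem/=|_]; last exact: cvg_cst.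
  by rewrite in_itv/= => /andP[y0 _]; exact: gg.
- by apply: L1Z; exact: integrable_indic_itv.
- move=> n y; rewrite patchE indicE; case: ifPn => [/set_mem/=|_].
    by rewrite in_itv/= => /andP[y0 _]; rewrite mulr1 gM.
  by rewrite normr0 mulr0.
Qed.

End ExponentialTestFunctions.

Section SteinKernel.
Context {d : measure_display} {T : measurableType d} {R : realType}.
Variables (P : probability T R) (W K : T -> R) (c : R).
Hypotheses (mW : mfun W) (W0 : forall w, 0 <= W w)
  (iW2 : L1 P (fun w => W w ^+ 2)) (iK : L1 P K).
Hypothesis expK : forall i : nat,
  Ex P (fun w => (W w - c) * expR (- (i%:R * W w))) =
  Ex P (fun w => K w * (- i%:R * expR (- (i%:R * W w)))).
Implicit Types (p : {poly R}) (x y a M : R) (f g : R -> R).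

Let mK : mfun K. Proof. exact: L1_measurable iK. Qed.

Let iW : L1 P W. Proof. by have [] := Ex_norm_le_sqrt mW iW2. Qed.

Let iWc : L1 P (fun w => `|W w - c|).
Proof. by apply: L1_norm; apply: L1B => //; exact: L1_cst. Qed.

Let expR_le1' (i : nat) w : `|expR (- (i%:R * W w))| <= 1.
Proof. by rewrite ger0_norm ?expR_ge0// expR_le1 oppr_le0 mulr_ge0. Qed.

Let mexp (i : nat) : mfun (fun w => expR (- (i%:R * W w))).
Proof.
by apply: measurableT_comp => //; apply: measurable_funN; exact: measurable_funM.
Qed.

Let mWc : mfun (fun w => W w - c). Proof. exact: measurable_funB. Qed.

Let iWce (i : nat) : L1 P (fun w => (W w - c) * expR (- (i%:R * W w))).
Proof.
apply: L1_le iWc _ => [|w]; first exact: measurable_funM.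
by rewrite normrM ler_piMr.
Qed.

Let iKe (i : nat) : L1 P (fun w => K w * expR (- (i%:R * W w))).
Proof.
apply: L1_le (L1_norm iK) _ => [|w]; first exact: measurable_funM.
by rewrite normrM ler_piMr.
Qed.

Let exp_poly_kernel a p : p.[0] = 0 ->
  Ex P (fun w => (W w - c) * exp_primitive a p (W w)) =
  Ex P (fun w => K w * p.[expR (- W w)]).
Proof.
rewrite horner_coef0 => p0.
pose b (i : 'I_(size p)) := p`_i / i%:R.
pose e (i : 'I_(size p)) w := expR (- (i%:R * W w)).
have Wc0 : Ex P (fun w => W w - c) = 0.
  have := expK 0; rewrite (eq_Ex P (g := fun w => W w - c)) => [->|w].
    rewrite (eq_Ex P (g := fun _ => 0)) ?Ex_0// => w.
    by rewrite oppr0 mul0r mulr0.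
  by rewrite mul0r oppr0 expR0 mulr1.
rewrite (eq_Ex P (g := fun w => (a + \sum_i b i) * (W w - c) -
    \sum_i b i * ((W w - c) * e i w))); last first.
  move=> w; have -> : exp_primitive a p (W w) =
      a + \sum_i b i - \sum_i b i * e i w.
    rewrite /exp_primitive -addrA -sumrB; congr (_ + _).
    by apply: eq_bigr => i _; rewrite /b /e; ring.
  rewrite mulrBr mulrC mulr_sumr; congr (_ - _).
  by apply: eq_bigr => i _; ring.
rewrite ExB; last 2 first.
- by apply: L1Z; apply: L1B => //; exact: L1_cst.
- by apply: L1_sum => i; apply: L1Z; exact: iWce.
rewrite ExZ ?Wc0; last by apply: L1B => //; exact: L1_cst.
rewrite mulr0 sub0r Ex_sum => [|i]; last by apply: L1Z; exact: iWce.
rewrite -sumrN (eq_Ex P (g := fun w =>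
  \sum_(i < size p) p`_i * (K w * e i w))); last first.
  move=> w; rewrite horner_expRN mulr_sumr.
  by apply: eq_bigr => i _; rewrite /e; ring.
rewrite Ex_sum => [|i]; last by apply: L1Z; exact: iKe.
apply: eq_bigr => i _; rewrite ExZ; last exact: iWce.
rewrite [X in _ * X]expK (eq_Ex P (g := fun w => - i%:R * (K w * e i w))).
  rewrite !ExZ; [|exact: iKe|exact: iKe].
  rewrite /b; case: (nat_of_ord i) => [|k]; first by rewrite p0; ring.
  by field; rewrite addrC natr1.
by move=> w; rewrite /e; ring.
Qed.

(** An integration by parts formula which holds for exponentials holds for all
    test functions with a bounded continuous derivative: in the variable
    [expR (- w)] the derivative is approximated by Bernstein polynomials, whose
    bound is uniform and whose convergence is pointwise. *)
Lemma kernel_of_exponentials f g M : (forall x, is_derive x 1 f (g x)) ->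
  continuous g -> (forall x, `|g x| <= M) ->
  Ex P (fun w => (W w - c) * f (W w)) = Ex P (fun w => K w * g (W w)).
Proof.
move=> df cg gM; have M0 : 0 <= M by exact: le_trans (gM 0).
(* [g] in the variable [u = expR (- y)]; the value 0 at 0 makes the constant terms
   of the Bernstein polynomials vanish *)
pose q (u : R) := if u <= 0 then 0 else g (- ln u).
have qM u : `|q u| <= M by rewrite /q; case: ifP => // _; rewrite normr0.
have qe y : q (expR (- y)) = g y by rewrite /q leNgt expR_gt0/= expRK opprK.
have q0 : q 0 = 0 by rewrite /q lexx.
have cq (u : R) : 0 < u -> {for u, continuous q}.
  move=> u0; have cgl : {for u, continuous (fun v => g (- ln v))}.
    apply: (@continuous_comp _ _ _ (fun v => - ln v) g); last exact: cg.
    by apply: continuousN; exact: continuous_ln.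
  have qu : q u = g (- ln u) by rewrite /q leNgt u0.
  have h : g (- ln v) @[v --> u] --> q u by rewrite qu; exact: cgl.
  apply: cvg_trans h; apply: near_eq_cvg; near=> v.
  have v0 : 0 < v by near: v; exact: lt_nbhsr.
  by rewrite /q leNgt v0.
pose p N := bernstein_of q N.
have p0 N : (p N).[0] = 0 by rewrite bernstein_at0 mul0r q0.
have e01 y : 0 <= y -> 0 <= expR (- y) <= 1.
  by move=> y0; rewrite expR_ge0 expR_le1 oppr_le0.
pose g_ N y := (p N).[expR (- y)]; pose f_ N := exp_primitive (f 0) (p N).
have gM_ N y : 0 <= y -> `|g_ N y| <= M.
  by move=> y0; apply: bernstein_of_bound => //; exact: e01.
have gg y : 0 <= y -> g_ N y @[N --> \oo] --> g y.
  move=> y0; rewrite -qe; apply: bernstein_of_cvg qM _ _; first exact: e01.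
  by apply: cq; exact: expR_gt0.
have cg_ N : continuous (g_ N).
  move=> y; apply: (@continuous_comp _ _ _ (fun y => expR (- y)) (horner (p N))).
    apply: (@continuous_comp _ _ _ (fun y : R => - y) expR).
      exact: opp_continuous.
    exact: continuous_expR.
  exact: continuous_horner.
have df_ N y : is_derive y 1 (f_ N) (g_ N y).
  by apply: is_derive_exp_primitive; exact: p0.
have ff y : 0 <= y -> f_ N y @[N --> \oo] --> f y.
  by apply: cvg_of_derivative df_ df cg_ cg _ gM_ gg => N; exact: exp_primitive0.
have fM_ N y : 0 <= y -> `|f_ N y| <= `|f 0| + M * y.
  move=> y0; have := norm_le_of_derive (df_ N) (gM_ N) y0.
  by rewrite /f_ exp_primitive0.
have mcW (h : R -> R) : continuous h -> mfun (fun w => h (W w)).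
  by move=> ch; apply: measurableT_comp mW; exact: continuous_mfun.
have cf := is_derive_continuous df.
have L : Ex P (fun w => (W w - c) * f_ N (W w)) @[N --> \oo] -->
    Ex P (fun w => (W w - c) * f (W w)).
  have iD : L1 P (fun w => `|W w - c| * (`|f 0| + M * W w)).
    apply: (@L1_le _ _ _ P _ (fun w => `|f 0| * `|c| +
        (`|f 0| + M * `|c|) * W w + M * W w ^+ 2)) => [||w].
    - apply: measurable_funM; first exact: L1_measurable iWc.
      by apply: measurable_funD => //; exact: measurable_funM.
    - apply: L1D; last exact: L1Z.
      by apply: L1D; [exact: L1_cst|exact: L1Z].
    - rewrite normrM normr_id (ger0_norm (_ : 0 <= `|f 0| + M * W w)); last first.
        by rewrite addr_ge0// mulr_ge0.
      apply: (@le_trans _ _ ((W w + `|c|) * (`|f 0| + M * W w))).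
        rewrite ler_wpM2r ?addr_ge0 ?mulr_ge0//.
        by rewrite (le_trans (ler_normB _ _))// (ger0_norm (W0 w)).
      by rewrite le_eqVlt; apply/orP; left; apply/eqP; ring.
  apply: (dominated_Ex _ _ _ iD _).2 => [N||w|N w].
  - apply: measurable_funM => //; apply: mcW; exact: is_derive_continuous (df_ N).
  - by apply: measurable_funM => //; exact: mcW.
  - by apply: cvgM; [exact: cvg_cst|exact: ff].
  - by rewrite normrM ler_wpM2l// fM_.
have Rr : Ex P (fun w => K w * g_ N (W w)) @[N --> \oo] -->
    Ex P (fun w => K w * g (W w)).
  apply: (dominated_Ex _ _ _ (L1Z M (L1_norm iK)) _).2 => [N||w|N w].
  - by apply: measurable_funM => //; exact: mcW.
  - by apply: measurable_funM => //; exact: mcW.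
  - by apply: cvgM; [exact: cvg_cst|exact: gg].
  - by rewrite normrM mulrC ler_wpM2r// gM_.
apply: cvg_unique L _ => //.
have -> : (fun N => Ex P (fun w => (W w - c) * f_ N (W w))) =
    (fun N => Ex P (fun w => K w * g_ N (W w))).
  by apply/funext => N; apply: exp_poly_kernel; exact: p0.
exact: Rr.
Unshelve. all: by end_near. Qed.

End SteinKernel.

(** * Stein's equation *)

Section SteinEquation.
Context {R : realType}.
Notation mu := (@lebesgue_measure R).
Implicit Types (f g h K k : R -> R) (x y z t : R).

Lemma le_of_derive_ge0 f g x y : (forall z, is_derive z 1 f (g z)) ->
  x <= y -> (forall z, x <= z <= y -> 0 <= g z) -> f x <= f y.
Proof.
move=> df xy g0; have cf : {within `[x, y], continuous f}.
  by apply: continuous_subspaceT; exact: is_derive_continuous df.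
have [z + e] := MVT_segment xy (fun z _ => df z) cf.
by rewrite in_itv/= => zxy; rewrite -subr_ge0 e mulr_ge0 ?subr_ge0// g0.
Qed.

Notation phi := (normal_pdf 0 (1 : R)).

Lemma phi_gt0 x : 0 < phi x.
Proof.
by rewrite normal_pdf_expR ?oner_neq0// mulr_gt0 ?expR_gt0// normal_peak_gt0 ?oner_neq0.
Qed.

Lemma is_derive_phi x : is_derive x 1 phi (- x * phi x).
Proof.
have := @is_derive_normal_pdf R 1 x (oner_neq0 _).
by rewrite expr1n divr1.
Qed.

Lemma phiN x : phi (- x) = phi x.
Proof. by rewrite !normal_pdf_expR ?oner_neq0// sqrrN. Qed.

Lemma cvg_phi : phi n%:R @[n --> \oo] --> 0.
Proof.
have [B B0 pB] := @normal_pdf_quartic R 1 (oner_neq0 _).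
apply: (@cvg_bounded_div _ _ (normal_peak 1 + B * normal_peak (2 * 1))) => n.
rewrite ger0_norm ?normal_pdf_ge0//.
apply: (@le_trans _ _ ((1 + n%:R ^+ 4) * phi n%:R)).
  rewrite ler_wpM2r ?normal_pdf_ge0// -natrX nat1r ler_nat.
  case: n => // n; rewrite (leq_trans _ (leqnSn _))//.
  by rewrite -[X in (X <= _)%N]expn1 leq_pexp2l.
rewrite mulrDl mul1r lerD ?normal_pdf_ub ?oner_neq0//.
apply: le_trans (pB _) _; apply: ler_wpM2l => //; apply: normal_pdf_ub.
by rewrite mulf_neq0 ?oner_neq0.
Qed.

Lemma L1_phi_bounded h : continuous h -> (forall x, 0 <= h x <= 1) ->
  L1 mu (fun x => h x * phi x).
Proof.
move=> ch h01; apply: L1_le (L1_normal_pdf 1) _ => [|x].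
  by apply: measurable_funM; [exact: continuous_mfun|exact: measurable_normal_pdf].
have /andP[h0 h1] := h01 x.
by rewrite ger0_norm ?mulr_ge0 ?normal_pdf_ge0// ler_piMl ?normal_pdf_ge0.
Qed.

Lemma Ex_phi : Ex mu phi = 1.
Proof. by rewrite /Ex /Rintegral integral_normal_pdf. Qed.

(** The Mills ratio estimate, in the form needed for the Stein equation: the
    primitive is compared with the normal density, whose derivative dominates
    [x * phi] beyond [x]. *)
Lemma mills_bound K k x : (forall y, is_derive y 1 K (k y)) ->
  (forall y, `|k y| <= phi y) ->
  K (- n%:R) @[n --> \oo] --> 0 -> K n%:R @[n --> \oo] --> 0 ->
  `|x * K x| <= phi x.
Proof.
move=> dK kphi K0 K1.
(* [D] vanishes at both ends and, for [t = x] and [t = - x], is monotone between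
   [x] and the end on the side of [x] *)
pose D (t : R) y := phi y - t * K y.
have dD (t : R) y : is_derive y 1 (D t) (- y * phi y - t * k y).
  have := is_derive_phi y; have := dK y => dK1 dp.
  by apply: is_derive_eq; rewrite /GRing.scale/=; ring.
have cD0 t : D t (- n%:R) @[n --> \oo] --> 0.
  rewrite -(subr0 (0 : R)) -[X in 0 - X](mulr0 t); apply: cvgB.
    by under eq_fun do rewrite phiN; exact: cvg_phi.
  by apply: cvgM; [exact: cvg_cst|].
have cD1 t : D t n%:R @[n --> \oo] --> 0.
  rewrite -(subr0 (0 : R)) -[X in 0 - X](mulr0 t); apply: cvgB; first exact: cvg_phi.
  by apply: cvgM; [exact: cvg_cst|].
have kle t y : `|t * k y| <= `|t| * phi y by rewrite normrM ler_wpM2l.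
have main t : `|t| = `|x| -> 0 <= D t x.
  move=> tx; have [x0|x0] := leP 0 x.
    rewrite -oppr_le0; have cN : - D t n%:R @[n --> \oo] --> 0.
      by rewrite -oppr0; apply: cvgN; exact: cD1.
    apply: (cvgr_to_ge cN); near=> n.
    have xn : x <= n%:R by near: n; exact: nbhs_infty_ger.
    rewrite lerN2; rewrite -lerN2.
    apply: (@le_of_derive_ge0 (fun y => - D t y) (fun y => y * phi y + t * k y)) => //.
      move=> y; have := dD t y => dDy.
      by apply: is_derive_eq; ring.
    move=> y /andP[xy _]; have := kle t y; rewrite tx (ger0_norm x0) ler_norml.
    move=> /andP[h _]; have : x * phi y <= y * phi y.
      by rewrite ler_wpM2r ?normal_pdf_ge0.
    lra.
  apply: (cvgr_to_le (cD0 t)); near=> n.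
  have xn : - n%:R <= x.
    rewrite lerNl (le_trans (ler_norm _))// normrN.
    by near: n; exact: nbhs_infty_ger.
  apply: (le_of_derive_ge0 (dD t)) => // y /andP[_ yx].
  have := kle t y; rewrite tx (ltr0_norm x0) ler_norml => /andP[_ h].
  have : - x * phi y <= - y * phi y.
    by rewrite ler_wpM2r ?normal_pdf_ge0// lerN2.
  lra.
have h1 := main x erefl; have h2 := main (- x) (normrN x).
rewrite /D in h1 h2; rewrite ler_norml; apply/andP; split; lra.
Unshelve. all: by end_near. Qed.

(** The solution is the primitive of [(h - c) * phi] divided by [phi]. The Mills
    ratio estimate bounds [x * f x], and with it [f' x], by a constant that does
    not depend on the smoothness of [h]. *)
Lemma stein_equation h : continuous h -> (forall x, 0 <= h x <= 1) ->
  exists f f', [/\ forall x, is_derive x 1 f (f' x), continuous f',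
    forall x, `|f' x| <= 2 &
    forall x, f' x - x * f x = h x - Ex mu (fun y => h y * phi y)].
Proof.
move=> ch h01; set c := Ex mu _.
have ih := L1_phi_bounded ch h01.
have ip : L1 mu phi := L1_normal_pdf 1.
have c0 : 0 <= c.
  by apply: Ex_ge0 => x; rewrite mulr_ge0 ?normal_pdf_ge0//; have /andP[] := h01 x.
have c1 : c <= 1.
  rewrite -Ex_phi; apply: le_Ex => // x.
  by rewrite ler_piMl ?normal_pdf_ge0//; have /andP[] := h01 x.
pose k x := h x * phi x - c * phi x.
have hc x : `|h x - c| <= 1.
  have /andP[h0 h1] := h01 x; rewrite ler_norml; apply/andP; split; lra.
have kphi x : `|k x| <= phi x.
  rewrite /k -mulrBl normrM (ger0_norm (normal_pdf_ge0 _ _ _)).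
  by rewrite ler_piMl ?normal_pdf_ge0.
have ik : L1 mu k by apply: L1B => //; exact: L1Z.
have cphi : continuous phi := @continuous_normal_pdf _ 0 1 (oner_neq0 _).
have ck : continuous k.
  move=> x; apply: cvgB; first by apply: cvgM; [exact: ch|exact: cphi].
  by apply: cvgM; [exact: cvg_cst|exact: cphi].
have k0 : Ex mu k = 0.
  by rewrite ExB ?ExZ ?Ex_phi ?mulr1 ?subrr//; exact: L1Z.
have [K [dK K0 K1]] := antiderivative ck ik; rewrite k0 in K1.
pose f x := K x * (phi x)^-1; pose f' x := (h x - c) + x * f x.
have df x : is_derive x 1 f (f' x).
  have := is_derive_phi x; have := dK x => dKx dp.
  have p0 : phi x != 0 by rewrite gt_eqF// phi_gt0.
  have dV : is_derive x 1 (fun y => (phi y)^-1) (x * (phi x)^-1).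
    apply: (is_derive_eq (is_deriveV p0 dp)).
    by rewrite /GRing.scale/=; field.
  by apply: is_derive_eq; rewrite /GRing.scale/= /f' /f /k; field.
exists f, f'; split => //.
- move=> x; apply: cvgD; first by apply: cvgB; [exact: ch|exact: cvg_cst].
  by apply: cvgM; [exact: cvg_id|exact: (is_derive_continuous df)].
- move=> x; rewrite (le_trans (ler_normD _ _))// mulr2n lerD//.
  rewrite /f mulrA normrM normfV (gtr0_norm (phi_gt0 x)).
  by rewrite ler_pdivrMr ?phi_gt0// mul1r; exact: mills_bound dK kphi K0 K1.
- by move=> x; rewrite /f'; ring.
Qed.

End SteinEquation.

(** * Quadratic forms in a Gaussian vector *)

Section QuadraticForms.
Context {d : measure_display} {T : measurableType d} {R : realType}.
Variables (P : probability T R) (n : nat) (Y : 'I_n -> {RV P >-> R}).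
Hypothesis gY : centred_gaussian Y.
Implicit Types (A : 'M[R]_n).
Notation cov := (cov Y).
Notation lin := (lin Y).
Notation bicov := (bicov Y).

Let delta (i : 'I_n) := fun j : 'I_n => (i == j)%:R : R.

Let bicov_dd i j : bicov (delta i) (delta j) = cov i j.
Proof. by rewrite -Ex_linM// /delta !lin_delta. Qed.

Lemma covC i j : cov i j = cov j i.
Proof. by apply: eq_Ex => w; rewrite mulrC. Qed.

Let polar i j k l (e1 e2 e3 : R) := fun m : 'I_n =>
  1 * (1 * (1 * delta i m + e1 * delta j m) + e2 * delta k m) + e3 * delta l m.

Let lin_polar i j k l e1 e2 e3 w : lin (polar i j k l e1 e2 e3) w =
  Y i w + e1 * Y j w + e2 * Y k w + e3 * Y l w.
Proof. by rewrite /polar !lin_comb !lin_delta !mul1r. Qed.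

Let bicov_polar i j k l e1 e2 e3 :
  bicov (polar i j k l e1 e2 e3) (polar i j k l e1 e2 e3) =
  cov i i + e1 ^+ 2 * cov j j + e2 ^+ 2 * cov k k + e3 ^+ 2 * cov l l +
  2 * (e1 * cov i j + e2 * cov i k + e3 * cov i l + e1 * e2 * cov j k +
       e1 * e3 * cov j l + e2 * e3 * cov k l).
Proof.
have H s t a b c : bicov c (fun m => s * a m + t * b m) =
    s * bicov c a + t * bicov c b.
  by rewrite bicovC// bicov_comb// !(bicovC gY c).
rewrite /polar !bicov_comb// !H !bicov_dd.
rewrite (covC j i) (covC k i) (covC k j) (covC l i) (covC l j) (covC l k); ring.
Qed.

(** Wick's formula for four factors, by polarization of the fourth moment of a
    normal variable over the eight choices of signs. *)
Lemma wick4 i j k l : Ex P (fun w => Y i w * Y j w * Y k w * Y l w) =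
  cov i j * cov k l + cov i k * cov j l + cov i l * cov j k.
Proof.
(* each signed fourth power contains the product with coefficient 24, and the
   other monomials cancel: 192 = 8 * 24 *)
pose signs : seq (R * R * R) := [seq (e, z) |
  e <- [seq (x, y) | x <- [:: 1; -1], y <- [:: 1; -1]], z <- [:: 1; -1]].
have e4 e1 e2 e3 : Ex P (fun w => lin (polar i j k l e1 e2 e3) w ^+ 4) =
    3 * bicov (polar i j k l e1 e2 e3) (polar i j k l e1 e2 e3) ^+ 2.
  exact: Ex_lin4.
have i4 e1 e2 e3 : L1 P (fun w => lin (polar i j k l e1 e2 e3) w ^+ 4).
  have [F nF /funext FY] := lin_RV gY (polar i j k l e1 e2 e3).
  by have [+ _ _] := centred_normal_moments nF; rewrite FY.
rewrite (eq_Ex P (g := fun w => \sum_(e <- signs) 192^-1 * (e.1.1 * e.1.2 * e.2) *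
    lin (polar i j k l e.1.1 e.1.2 e.2) w ^+ 4)); last first.
  by move=> w; rewrite /signs /= !big_cons big_nil !lin_polar /=; field.
rewrite Ex_sum => [|e]; last exact: L1Z.
under eq_bigr do rewrite ExZ// e4 bicov_polar.
by rewrite /signs /= !big_cons big_nil /=; field.
Qed.

Definition qform A w : R := \sum_i \sum_j A i j * (Y i w * Y j w).

Lemma L1_qform A : L1 P (qform A).
Proof. by apply: L1_sum => i; apply: L1_sum => j; apply: L1Z; exact: L1_YY. Qed.

Lemma covmxE i j : covmx Y i j = cov i j.
Proof. by rewrite mxE unlock. Qed.

Lemma covmx_sym : (covmx Y)^T = covmx Y.
Proof. by apply/matrixP => i j; rewrite mxE !covmxE covC. Qed.

Lemma Ex_qform A : Ex P (qform A) = \tr (A *m (covmx Y)^T).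
Proof.
rewrite /qform Ex_sum => [|i]; last first.
  by apply: L1_sum => j; apply: L1Z; exact: L1_YY.
apply: eq_bigr => i _; rewrite Ex_sum => [|j]; last by apply: L1Z; exact: L1_YY.
rewrite mxE; apply: eq_bigr => j _; rewrite ExZ; last exact: L1_YY.
by rewrite mxE covmxE.
Qed.

Lemma qformM A B w : qform A w * qform B w =
  \sum_i \sum_j \sum_k \sum_l A i j * B k l * (Y i w * Y j w * Y k w * Y l w).
Proof.
rewrite /qform mulr_suml; apply: eq_bigr => i _.
rewrite mulr_suml; apply: eq_bigr => j _.
rewrite mulr_sumr; apply: eq_bigr => k _.
by rewrite mulr_sumr; apply: eq_bigr => l _; ring.
Qed.

Let L1_4 (A : 'I_n -> 'I_n -> 'I_n -> 'I_n -> R) i j k l :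
  L1 P (fun w => A i j k l * (Y i w * Y j w * Y k w * Y l w)).
Proof. by apply: L1Z; exact: L1_YYYY. Qed.

Lemma L1_qform_sqr A : L1 P (fun w => qform A w ^+ 2).
Proof.
apply: (@eq_L1 _ _ _ P (fun w => qform A w * qform A w)) => [w|].
  by rewrite expr2.
under eq_fun do rewrite qformM.
do 4 (apply: L1_sum => ?); exact: (L1_4 (fun i j k l => A i j * A k l)).
Qed.

Lemma Ex_qform_sqr A : A^T = A ->
  Ex P (fun w => qform A w ^+ 2) =
  Ex P (qform A) ^+ 2 + 2 * \tr (A *m covmx Y *m (A *m covmx Y)).
Proof.
move=> sA; have As i j : A i j = A j i by rewrite -{1}sA mxE.
have i4 := L1_4 (fun i j k l => A i j * A k l).
rewrite (eq_Ex P (g := fun w => \sum_i \sum_j \sum_k \sum_l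
    A i j * A k l * (Y i w * Y j w * Y k w * Y l w))); last first.
  by move=> w; rewrite expr2 qformM.
transitivity (\sum_i \sum_j \sum_k \sum_l A i j * A k l *
    (cov i j * cov k l + cov i k * cov j l + cov i l * cov j k)).
  do 4 (rewrite Ex_sum; last (by move=> ?; do 4? (apply: L1_sum => ?); exact: i4);
    apply: eq_bigr => ? _).
  by rewrite ExZ ?wick4//; exact: L1_YYYY.
have -> : \tr (A *m covmx Y *m (A *m covmx Y)) =
    \sum_i \sum_j \sum_k \sum_l A i j * A k l * (cov i l * cov j k).
  apply: eq_bigr => i _; rewrite mxE.
  under eq_bigr => k _.
    rewrite !mxE big_distrlr /=.
    over.
  rewrite exchange_big /=; apply: eq_bigr => j _; apply: eq_bigr => k _.
  by apply: eq_bigr => l _; rewrite !covmxE (covC l i); ring.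
have eqq : \sum_i \sum_j \sum_k \sum_l A i j * A k l * (cov i l * cov j k) =
    \sum_i \sum_j \sum_k \sum_l A i j * A k l * (cov i k * cov j l).
  apply: eq_bigr => i _; apply: eq_bigr => j _; rewrite exchange_big/=.
  by apply: eq_bigr => k _; apply: eq_bigr => l _; rewrite (As l k).
have -> : Ex P (qform A) ^+ 2 =
    \sum_i \sum_j \sum_k \sum_l A i j * A k l * (cov i j * cov k l).
  have -> : Ex P (qform A) = \sum_i \sum_j A i j * cov i j.
    rewrite Ex_qform; apply: eq_bigr => i _; rewrite mxE; apply: eq_bigr => j _.
    by rewrite covmx_sym covmxE covC.
  rewrite expr2 mulr_suml; apply: eq_bigr => i _.
  rewrite mulr_suml; apply: eq_bigr => j _.
  rewrite mulr_sumr; apply: eq_bigr => k _.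
  by rewrite mulr_sumr; apply: eq_bigr => l _; ring.
rewrite mulr2n mulrDl mul1r {2}eqq -!big_split/=; apply: eq_bigr => i _.
rewrite -!big_split/=; apply: eq_bigr => j _.
rewrite -!big_split/=; apply: eq_bigr => k _.
rewrite -!big_split/=; apply: eq_bigr => l _; ring.
Qed.

End QuadraticForms.

(** * Eigenvalues and traces *)

Section Eigenvalues.
Context {R : realType}.
Implicit Types (n : nat).

Lemma comp_polyXn_inj n (p q : {poly R}) : (0 < n)%N ->
  p \Po 'X^n = q \Po 'X^n -> p = q.
Proof.
move=> n0 e; apply/polyP => i; have := congr1 (fun r : {poly R} => r`_(i * n)) e.
by rewrite !coef_comp_poly_Xn// dvdn_mull// mulnK.
Qed.

(** The eigenvalues of the square come from the factorization
    [X^2 - A^2 = (X - A) (X + A)]. *)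
Lemma eigenvalues_of_sqr n (A : 'M[R]_n) lam : eigenvalues_of A lam ->
  eigenvalues_of (A *m A) (fun k => lam k ^+ 2).
Proof.
move=> eA; apply: (@comp_polyXn_inj 2) => //.
have hA : \det ('X%:M - map_mx polyC A) = \prod_(k < n) ('X - (lam k)%:P).
  exact: eA.
have hB : \det ('X%:M + map_mx polyC A) = \prod_(k < n) ('X + (lam k)%:P).
  have := congr1 (comp_poly (- 'X)) eA.
  rewrite /char_poly -det_map_mx /char_poly_mx map_mxB map_scalar_mx /= comp_polyX.
  have -> : map_mx (comp_poly (- 'X)) (map_mx polyC A) = map_mx polyC A.
    by apply/matrixP => i j; rewrite !mxE comp_polyC.
  rewrite rmorph_prod /=.
  have -> : (- 'X)%:M - map_mx polyC A = -1 *: ('X%:M + map_mx polyC A).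
    by rewrite scaleN1r opprD raddfN.
  rewrite detZ => e.
  have {e} : (-1) ^+ n * \det ('X%:M + map_mx polyC A) =
      (-1) ^+ n * \prod_(k < n) ('X + (lam k)%:P).
    rewrite e -[X in (-1) ^+ X * _]card_ord -prodrN; apply: eq_bigr => k _.
    by rewrite comp_polyB comp_polyX comp_polyC opprD.
  by apply: mulfI; rewrite expf_neq0// oppr_eq0 oner_eq0.
rewrite /char_poly -det_map_mx /char_poly_mx map_mxB map_scalar_mx /= comp_polyX.
have -> : map_mx (comp_poly 'X^2) (map_mx polyC (A *m A)) =
    map_mx polyC A *m map_mx polyC A.
  by rewrite -map_mxM; apply/matrixP => i j; rewrite !mxE comp_polyC.
have -> : ('X^2)%:M - map_mx polyC A *m map_mx polyC A =
    ('X%:M - map_mx polyC A) *m ('X%:M + map_mx polyC A).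
  rewrite mulmxBl !mulmxDr -scalar_mxM -expr2 -scalar_mxC opprD addrA.
  by rewrite addrK.
rewrite det_mulmx hA hB rmorph_prod/= -big_split/=; apply: eq_bigr => k _.
rewrite comp_polyB comp_polyX comp_polyC polyCM; ring.
Qed.

Lemma mxtrace_eigenvalues n (A : 'M[R]_n) lam : eigenvalues_of A lam ->
  \tr A = \sum_(k < n) lam k.
Proof.
case: n A lam => [|n] A lam eA.
  by rewrite /mxtrace !big_ord0.
have := char_poly_trace A (ltn0Sn n); rewrite eA.
have -> : \prod_(k < n.+1) ('X - (lam k)%:P) =
    \prod_(x <- [seq lam k | k <- index_enum 'I_n.+1]) ('X - x%:P).
  by rewrite big_map.
have sz : size [seq lam k | k <- index_enum 'I_n.+1] = n.+1.
  by rewrite size_map -sum1_size sum_nat_const card_ord muln1.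
have := @coefPn_prod_XsubC _ [seq lam k | k <- index_enum 'I_n.+1].
rewrite sz => ->// /oppr_inj <-; by rewrite big_map.
Qed.

(** Gershgorin's bound: read the eigenvalue equation at an entry of an
    eigenvector of largest absolute value. *)
Lemma eigenvalue_le_row_sum n (A : 'M[R]_n) lam k (M : R) :
  eigenvalues_of A lam -> (forall j, \sum_i `|A i j| <= M) -> `|lam k| <= M.
Proof.
move=> eA AM; have : root (char_poly A) (lam k).
  rewrite eA /root horner_prod; apply/prodf_eq0.
  by exists k => //; rewrite !hornerE subrr.
rewrite -eigenvalue_root_char => /eigenvalueP[v vA v0].
have [j0 vj0] : exists j, v 0 j != 0.
  apply/existsP; apply: contra_neqT v0 => /existsPn h.
  by apply/rowP => j; rewrite mxE; apply/eqP/negPn/h.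
have [j _ hj] := @arg_maxP _ _ _ j0 xpredT (fun j => `|v 0 j|) isT.
have vj : 0 < `|v 0 j| by apply: lt_le_trans (hj j0 isT); rewrite normr_gt0.
rewrite -(ler_pM2r vj) -normrM.
have -> : lam k * v 0 j = \sum_i v 0 i * A i j.
  by have := congr1 (fun u : 'rV_n => u 0 j) vA; rewrite !mxE => ->.
apply: le_trans (ler_norm_sum _ _ _) _.
apply: (@le_trans _ _ (\sum_i `|A i j| * `|v 0 j|)).
  by apply: ler_sum => i _; rewrite normrM mulrC; apply: ler_wpM2l => //; exact: hj.
by rewrite -mulr_suml ler_wpM2r.
Qed.

End Eigenvalues.

(** * The Stein kernel of the squared norm *)

Section NormalApproximation.
Context {d : measure_display} {T : measurableType d} {R : realType}.
Variables (P : probability T R) (n : nat) (Y : 'I_n -> {RV P >-> R}).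
Hypothesis gY : centred_gaussian Y.
Notation mu := (@lebesgue_measure R).
Notation C := (covmx Y).
Notation W := (sqnorm Y).

Lemma sqnormE w : W w = qform Y 1%:M w.
Proof.
apply: eq_bigr => i _; rewrite (bigD1 i)//= mxE eqxx mul1r big1 ?addr0//.
by move=> j ji; rewrite mxE eq_sym (negbTE ji) mul0r.
Qed.

Lemma msqnorm : mfun W.
Proof. by apply: measurable_sum => i; apply: measurable_funX; exact: mY. Qed.

Lemma sqnorm_ge0 w : 0 <= W w.
Proof. by apply: sumr_ge0 => i _; exact: sqr_ge0. Qed.

Lemma L1_sqnorm : L1 P W.
Proof. by rewrite (funext sqnormE); exact: L1_qform. Qed.

Lemma L1_sqnorm_sqr : L1 P (fun w => W w ^+ 2).
Proof. by under eq_fun do rewrite sqnormE; exact: L1_qform_sqr. Qed.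

Lemma Ex_sqnorm : Ex P W = \tr C.
Proof. by rewrite (funext sqnormE) Ex_qform// mul1mx mxtrace_tr. Qed.

Lemma Ex_sqnorm_sqr : Ex P (fun w => W w ^+ 2) = (\tr C) ^+ 2 + 2 * \tr (C *m C).
Proof.
under eq_Ex do rewrite sqnormE; rewrite Ex_qform_sqr ?tr_scalar_mx// !mul1mx.
by rewrite -Ex_sqnorm (funext sqnormE).
Qed.

(** In coordinates that diagonalize the covariance, this is the sum of the
    [2 * lam_k ^ 2 * N_k ^ 2], where the [k]th coordinate has variance [lam_k] and
    [N_k] is standard normal. *)
Definition kernel := qform Y (2 *: C).

Lemma Ex_kernel : Ex P kernel = 2 * \tr (C *m C).
Proof. by rewrite Ex_qform// covmx_sym -scalemxAl mxtraceZ. Qed.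

Lemma Ex_kernel_variance : Ex P (fun w => (kernel w - 2 * \tr (C *m C)) ^+ 2) =
  8 * \tr (C *m C *m (C *m C)).
Proof.
have sA : (2 *: C)^T = 2 *: C by rewrite linearZ/= covmx_sym.
have i2 := L1_qform_sqr gY (2 *: C); have i1 := L1_qform gY (2 *: C).
rewrite (eq_Ex P (g := fun w => kernel w ^+ 2 -
  4 * \tr (C *m C) * kernel w + 4 * \tr (C *m C) ^+ 2)); last by move=> w; ring.
rewrite ExD; [|by apply: L1B => //; exact: L1Z|exact: L1_cst].
rewrite ExB//; last exact: L1Z.
rewrite ExZ// Ex_cst Ex_qform_sqr// -/kernel Ex_kernel.
rewrite -!scalemxAl -scalemxAr scalerA mxtraceZ; ring.
Qed.

Lemma kernel_exponential (i : nat) :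
  Ex P (fun w => (W w - \tr C) * expR (- (i%:R * W w))) =
  Ex P (fun w => kernel w * (- i%:R * expR (- (i%:R * W w)))).
Proof.
set F := fun w => expR (- (i%:R * W w)).
have mF : mfun F.
  by apply: measurableT_comp => //; apply: measurable_funN;
     apply: measurable_funM => //; exact: msqnorm.
have F1 w : `|F w| <= 1.
  by rewrite ger0_norm ?expR_ge0// expR_le1 oppr_le0 mulr_ge0// sqnorm_ge0.
have iF : L1 P F by exact: L1_bounded.
have iYYF j k : L1 P (fun w => Y j w * Y k w * F w).
  apply: L1_le (L1_norm (L1_YY gY j k)) _ => [|w].
    by apply: measurable_funM => //; apply: measurable_funM; exact: mY.
  by rewrite normrM ler_piMr.
rewrite (eq_Ex P (g := fun w => (\sum_j Y j w * Y j w * F w) - \tr C * F w));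
  last first.
  by move=> w; rewrite mulrBl -mulr_suml; congr (_ * _ - _); apply: eq_bigr.
rewrite ExB; [|exact: L1_sum|exact: L1Z].
rewrite Ex_sum// ExZ//.
under eq_bigr => j _ do rewrite expR_sqnorm_ibp//.
rewrite sumrB -mulr_suml -mulr_sumr.
have -> : \sum_j cov Y j j = \tr C by apply: eq_bigr => j _; rewrite covmxE.
rewrite addrAC subrr sub0r.
rewrite (eq_Ex P (g := fun w => \sum_j \sum_k - (2 * i%:R) * cov Y j k *
    (Y j w * Y k w * F w))); last first.
  move=> w; rewrite /kernel /qform mulr_suml; apply: eq_bigr => j _.
  rewrite mulr_suml; apply: eq_bigr => k _; rewrite !mxE -covmxE /F.
  by rewrite -[covmx Y j k]/(C j k) !mxE; ring.
rewrite Ex_sum => [|j]; last by apply: L1_sum => k; exact: L1Z.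
rewrite mulr_sumr -sumrN; apply: eq_bigr => j _.
rewrite Ex_sum => [|k]; last exact: L1Z.
by rewrite mulr_sumr -sumrN; apply: eq_bigr => k _; rewrite ExZ//; ring.
Qed.

Hypothesis C0 : 0 < \tr (C *m C).
Let s : R := Num.sqrt (2 * \tr (C *m C)).
Notation phi := (normal_pdf 0 (1 : R)).

(** Stein's method: the error is the mean deviation of the kernel from its
    expectation, weighted by the derivative of the solution of Stein's
    equation. *)
Lemma stein_bound (h : R -> R) : continuous h -> (forall x, 0 <= h x <= 1) ->
  `|Ex P (fun w => h ((W w - \tr C) / s)) - Ex mu (fun x => h x * phi x)| <=
  Num.sqrt (8 * \tr (C *m C *m (C *m C))) / \tr (C *m C).
Proof.
move=> ch h01; have [f [f' [df cf' f'2 fE]]] := stein_equation ch h01.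
set c := Ex mu _ in fE *.
have v0 : 0 < 2 * \tr (C *m C) by rewrite mulr_gt0.
have s0 : 0 < s by rewrite sqrtr_gt0.
have ss : s ^+ 2 = 2 * \tr (C *m C) by rewrite sqr_sqrtr// ltW.
pose F w := (W w - \tr C) / s.
have mF : mfun F.
  by apply: measurable_funM => //; apply: measurable_funB => //; exact: msqnorm.
have mcF (g : R -> R) : continuous g -> mfun (fun w => g (F w)).
  by move=> cg; apply: measurableT_comp mF; exact: continuous_mfun.
have cf := is_derive_continuous df.
have ihF : L1 P (fun w => h (F w)).
  apply: L1_bounded => [|w]; first exact: mcF.
  by have /andP[h0 h1] := h01 (F w); rewrite ger0_norm.
have if' : L1 P (fun w => f' (F w)).
  by apply: L1_le (L1_cst P 2) _ => [|w]; [exact: mcF|exact: f'2].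
have iFf : L1 P (fun w => F w * f (F w)).
  apply: (@eq_L1 _ _ _ P (fun w => f' (F w) - (h (F w) - c))) => [w|].
    by rewrite -fE; ring.
  by apply: L1B => //; apply: L1B => //; exact: L1_cst.
have iK : L1 P kernel by exact: L1_qform.
have iKf' : L1 P (fun w => kernel w * f' (F w)).
  apply: L1_le (L1Z 2 (L1_norm iK)) _ => [|w].
    by apply: measurable_funM; [exact: L1_measurable iK|exact: mcF].
  by rewrite normrM mulrC ler_wpM2r.
have id1 : Ex P (fun w => h (F w)) - c = Ex P (fun w => f' (F w)) -
    Ex P (fun w => F w * f (F w)).
  rewrite -ExB// -[X in _ - X](Ex_cst P) -ExB//; last exact: L1_cst.
  by apply: eq_Ex => w; rewrite fE.
have id2 : Ex P (fun w => F w * f (F w)) =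
    (s ^+ 2)^-1 * Ex P (fun w => kernel w * f' (F w)).
  pose g x := s^-1 * f ((x - \tr C) / s).
  pose g' x := (s ^+ 2)^-1 * f' ((x - \tr C) / s).
  have dg (x : R) : is_derive x 1 g (g' x).
    have dfx := df ((x - \tr C) / s).
    have d1 : is_derive x 1 (fun y : R => (y - \tr C) / s) (s^-1).
      apply: is_derive_eq; rewrite /GRing.scale/= ?mulr1 ?addr0 ?subr0; ring.
    have d2 := @is_derive1_comp R f (fun y => (y - \tr C) / s) x _ _ dfx d1.
    have d3 : is_derive x 1 (fun y => s^-1 * (f \o (fun y => (y - \tr C) / s)) y)
       (s^-1 * (f' ((x - \tr C) / s) * s^-1)).
      by apply: is_derive_eq; rewrite /GRing.scale/=; ring.
    by apply: (is_derive_eq d3); rewrite /g'; field; rewrite gt_eqF.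
  have cg' : continuous g'.
    move=> x; apply: cvgM; first exact: cvg_cst.
    apply: (@continuous_comp _ _ _ (fun y => (y - \tr C) / s) f'); last exact: cf'.
    by apply: cvgM; [apply: cvgB; [exact: cvg_id|exact: cvg_cst]|exact: cvg_cst].
  have g'b x : `|g' x| <= (s ^+ 2)^-1 * 2.
    rewrite normrM ger0_norm ?invr_ge0 ?sqr_ge0// ler_wpM2l ?invr_ge0 ?sqr_ge0//.
  have := kernel_of_exponentials msqnorm sqnorm_ge0 L1_sqnorm_sqr iK
    kernel_exponential dg cg' g'b.
  rewrite (eq_Ex P (g := fun w => F w * f (F w))); last first.
    by move=> w; rewrite /g /F; ring.
  by move=> ->; rewrite -ExZ//; apply: eq_Ex => w; rewrite /g' /F; ring.
rewrite -/F id1 id2 -ExZ// -ExB//; last exact: L1Z.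
have mK : mfun kernel by exact: L1_measurable iK.
have iv : L1 P (fun w => (kernel w - 2 * \tr (C *m C)) ^+ 2).
  apply: (@eq_L1 _ _ _ P (fun w => kernel w ^+ 2 -
    4 * \tr (C *m C) * kernel w + 4 * \tr (C *m C) ^+ 2)) => [w|]; first by ring.
  apply: L1D; last exact: L1_cst.
  by apply: L1B; [exact: L1_qform_sqr|exact: L1Z].
have mKc : mfun (fun w => kernel w - 2 * \tr (C *m C)) by exact: measurable_funB.
have [ik Kv] := Ex_norm_le_sqrt mKc iv.
rewrite Ex_kernel_variance in Kv.
have bnd w : `|f' (F w) - (s ^+ 2)^-1 * (kernel w * f' (F w))| <=
    (\tr (C *m C))^-1 * `|kernel w - 2 * \tr (C *m C)|.
  have -> : f' (F w) - (s ^+ 2)^-1 * (kernel w * f' (F w)) =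
      (2 * \tr (C *m C))^-1 * (- f' (F w)) * (kernel w - 2 * \tr (C *m C)).
    by rewrite ss; field; rewrite gt_eqF.
  rewrite normrM ler_wpM2r// normrM normrN ger0_norm ?invr_ge0 ?(ltW v0)//.
  have -> : (2 * \tr (C *m C))^-1 * `|f' (F w)| =
      `|f' (F w)| / 2 * (\tr (C *m C))^-1 by field; rewrite gt_eqF.
  by apply: ler_piMl; [rewrite invr_ge0 ltW|rewrite ler_pdivrMr// mul1r].
have iL : L1 P (fun w => f' (F w) - (s ^+ 2)^-1 * (kernel w * f' (F w))).
  by apply: L1B => //; exact: L1Z.
apply: le_trans (normr_Ex iL) _.
apply: (@le_trans _ _ (Ex P (fun w => (\tr (C *m C))^-1 *
    `|kernel w - 2 * \tr (C *m C)|))).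
  by apply: le_Ex => //; [exact: L1_norm|apply: L1Z; exact: L1_norm].
rewrite ExZ; last exact: L1_norm.
rewrite mulrC; apply: ler_wpM2r Kv.
by rewrite invr_ge0 ltW.
Qed.

End NormalApproximation.

(** * From smooth test functions to distribution functions *)

Section Kolmogorov.
Context {R : realType}.
Notation mu := (@lebesgue_measure R).
Notation phi := (normal_pdf 0 (1 : R)).
Implicit Types (a b x : R).

Definition ramp a b x : R := Num.max 0 (Num.min 1 ((b - x) / (b - a))).

Lemma continuous_ramp a b : continuous (ramp a b).
Proof.
move=> x; have c1 : {for x, continuous (fun y => (b - y) / (b - a))}.
  by apply: cvgM; [apply: cvgB; [exact: cvg_cst|exact: cvg_id]|exact: cvg_cst].
have cst_cont (c : R) : {for x, continuous (fun _ : R => c)} by exact: cvg_cst.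
have c2 := continuous_min (cst_cont 1) c1.
have c3 := continuous_max (cst_cont 0) c2.
exact: c3.
Qed.

Lemma ramp01 a b x : 0 <= ramp a b x <= 1.
Proof. by rewrite le_max lexx/= ge_max ler01/= ge_min lexx. Qed.

Lemma ramp1 a b x : a < b -> x <= a -> ramp a b x = 1.
Proof.
move=> ab xa; rewrite /ramp min_l ?max_r//.
by rewrite ler_pdivlMr ?subr_gt0// mul1r lerD2l lerN2.
Qed.

Lemma ramp0 a b x : a < b -> b <= x -> ramp a b x = 0.
Proof.
move=> ab xb; rewrite /ramp max_l// ge_min; apply/orP; right.
by rewrite ler_pdivrMr ?subr_gt0// mul0r subr_le0.
Qed.

Definition normal_cdf x : R := Ex mu (fun y => \1_`]-oo, x] y * phi y).

Let miN x : mfun (\1_`]-oo, x] : R -> R).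
Proof. exact: measurable_indic. Qed.

Let L1_cdf x : L1 mu (fun y => \1_`]-oo, x] y * phi y).
Proof.
apply: L1_le (L1_normal_pdf 1) _ => [|y].
  by apply: measurable_funM => //; exact: measurable_normal_pdf.
by rewrite ger0_norm ?mulr_ge0 ?normal_pdf_ge0// ler_piMl ?normal_pdf_ge0.
Qed.

Lemma Ex_ramp_between a b : a < b ->
  normal_cdf a <= Ex mu (fun y => ramp a b y * phi y) /\
  Ex mu (fun y => ramp a b y * phi y) <= normal_cdf b.
Proof.
move=> ab; have ir := L1_phi_bounded (@continuous_ramp a b) (ramp01 a b).
split; apply: le_Ex => // y; rewrite ler_wpM2r ?normal_pdf_ge0// indicE.
  case: (boolP (_ \in _)) => [/set_mem/=|_]; last by have /andP[] := ramp01 a b y.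
  by rewrite in_itv/= => ya; rewrite ramp1.
case: (boolP (_ \in _)) => [_|]; first by have /andP[] := ramp01 a b y.
by rewrite notin_setE/= in_itv/= => /negP; rewrite -ltNge => /ltW yb; rewrite ramp0.
Qed.

Lemma normal_cdf_lipschitz a b : a < b ->
  normal_cdf b <= normal_cdf a + normal_peak 1 * (b - a).
Proof.
move=> ab.
have ii : L1 mu (\1_`]a, b] : R -> R) by exact: integrable_indic_itv.
have -> : normal_peak 1 * (b - a) = Ex mu (fun y => normal_peak 1 * \1_`]a, b] y).
  rewrite ExZ//; congr (_ * _); rewrite /Ex /Rintegral integral_indic//= setIT.
  by rewrite lebesgue_measure_itv/= lte_fin ab.
rewrite -ExD//; last exact: L1Z.
apply: le_Ex => //; first by apply: L1D => //; exact: L1Z.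
move=> y; rewrite !indicE !mem_setE !in_itv/=.
have py : phi y <= normal_peak 1 by apply: normal_pdf_ub; exact: oner_neq0.
have p0 : 0 <= phi y by exact: normal_pdf_ge0.
have k0 : 0 <= normal_peak (1 : R) by exact: normal_peak_ge0.
by case: (leP y b) => yb; case: (leP y a) => ya /=;
  rewrite ?mul1r ?mul0r ?mulr1 ?mulr0; lra.
Qed.

Lemma normal_prob_le x : normal_prob 0 1 `]-oo, x] = (normal_cdf x)%:E.
Proof.
have := L1_cdf x; move=> /(integrable_fin_num measurableT) h.
rewrite /normal_cdf /Ex /Rintegral fineK//.
rewrite /normal_prob [LHS]integral_mkcond; apply: eq_integral => y _.
by rewrite patchE indicE; case: ifPn => _; rewrite ?mul1r ?mul0r.
Qed.

Lemma normal_prob_lt x : normal_prob 0 1 [set z | z < x] = (normal_cdf x)%:E.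
Proof.
rewrite -normal_prob_le /normal_prob.
rewrite -[in RHS](@integral_itv_bndo_bndc R).
  congr (integral _ _ _); apply/seteqP; split => z /=; by rewrite in_itv.
apply/measurable_EFinP; apply: measurable_funTS; exact: measurable_normal_pdf.
Qed.

(** Passing from continuous test functions to half-lines costs nothing, because
    the error [K] does not depend on the steepness of the ramp. *)
Lemma kolmogorov_le d (T : measurableType d) (P : probability T R) (F : T -> R)
    (K : R) : mfun F ->
  (forall h : R -> R, continuous h -> (forall x, 0 <= h x <= 1) ->
    `|Ex P (fun w => h (F w)) - Ex mu (fun y => h y * phi y)| <= K) ->
  forall x, normal_cdf x - K <= fine (P [set w | F w < x]) /\
    fine (P [set w | F w <= x]) <= normal_cdf x + K.
Proof.
move=> mF test x.
have mlt : measurable [set w | F w < x].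
  rewrite (_ : [set w | _] = F @^-1` `]-oo, x[); last first.
    by apply/seteqP; split => z /=; rewrite in_itv.
  by rewrite -[X in measurable X]setTI; apply: mF.
have mle : measurable [set w | F w <= x].
  rewrite (_ : [set w | _] = F @^-1` `]-oo, x]); last first.
    by apply/seteqP; split => z /=; rewrite in_itv.
  by rewrite -[X in measurable X]setTI; apply: mF.
have PE A : measurable A -> L1 P (\1_A : T -> R) /\ fine (P A) = Ex P (\1_A : T -> R).
  move=> mA; split; last by rewrite /Ex /Rintegral integral_indic// setIT.
  apply: L1_bounded => [|w]; first exact: measurable_indic.
  by rewrite indicE; case: (_ \in _); rewrite ?normr1 ?normr0.
have iF a b : L1 P (fun w => ramp a b (F w)).
  apply: L1_bounded => [|w].
    by apply: measurableT_comp mF; apply: continuous_mfun; exact: continuous_ramp.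
  by have /andP[r0 r1] := ramp01 a b (F w); rewrite ger0_norm.
have k0 : 0 < normal_peak (1 : R) by rewrite normal_peak_gt0// oner_neq0.
split; apply/ler_addgt0Pr => e e0; set dl := e / normal_peak 1;
  have dl0 : 0 < dl by [rewrite divr_gt0].
- have ab : x - dl < x by rewrite gtrBl.
  have [h1 _] := Ex_ramp_between ab.
  have h2 := normal_cdf_lipschitz ab.
  have h3 := test _ (@continuous_ramp (x - dl) x) (ramp01 _ _).
  have [i1 e1] := PE _ mlt.
  have h4 : Ex P (fun w => ramp (x - dl) x (F w)) <= fine (P [set w | F w < x]).
    rewrite e1; apply: le_Ex => // w; rewrite indicE.
    case: (boolP (_ \in _)) => [_|]; first by have /andP[] := ramp01 (x - dl) x (F w).
    by rewrite notin_setE/= => /negP; rewrite -leNgt => xF; rewrite ramp0.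
  have h5 : normal_peak 1 * (x - (x - dl)) = e by rewrite /dl; field; rewrite gt_eqF.
  rewrite h5 in h2; move: h3; rewrite ler_norml => /andP[h3 _]; lra.
- have ab : x < x + dl by rewrite ltrDl.
  have [_ h1] := Ex_ramp_between ab.
  have h2 := normal_cdf_lipschitz ab.
  have h3 := test _ (@continuous_ramp x (x + dl)) (ramp01 _ _).
  have [i1 e1] := PE _ mle.
  have h4 : fine (P [set w | F w <= x]) <= Ex P (fun w => ramp x (x + dl) (F w)).
    rewrite e1; apply: le_Ex => // w; rewrite indicE.
    case: (boolP (_ \in _)) => [/set_mem/= xF|_]; first by rewrite ramp1.
    by have /andP[] := ramp01 x (x + dl) (F w).
  have h5 : normal_peak 1 * ((x + dl) - x) = e by rewrite /dl; field; rewrite gt_eqF.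
  rewrite h5 in h2; move: h3; rewrite ler_norml => /andP[_ h3]; lra.
Qed.

End Kolmogorov.

(** * The Berry-Esseen bound *)

Section BerryEsseen.
Context {d : measure_display} {T : measurableType d} {R : realType}.
Variables (P : probability T R) (n : nat) (Y : 'I_n -> {RV P >-> R}).
Hypothesis gY : centred_gaussian Y.
Notation C := (covmx Y).
Notation V := (centred_square_sum Y).

Lemma centred_square_sumE w : V w = sqnorm Y w - \tr C.
Proof.
rewrite /centred_square_sum mfun_sum /sqnorm -sumrB; apply: eq_bigr => k _.
by rewrite mxE !expr2.
Qed.

Lemma centred_square_sum_variance : 'V_P[V] = (2 * \tr (C *m C))%:E.
Proof.
have iW := L1_sqnorm gY; have iW2 := L1_sqnorm_sqr gY.
have mean0 : fine 'E_P[V] = 0.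
  rewrite unlock -/(Rintegral P setT V) -/(Ex P V).
  rewrite (funext centred_square_sumE) ExB ?Ex_cst ?Ex_sqnorm ?subrr//.
  exact: L1_cst.
have i2 : L1 P (fun w => V w ^+ 2).
  apply: (@eq_L1 _ _ _ P (fun w => sqnorm Y w ^+ 2 - 2 * \tr C * sqnorm Y w +
    \tr C ^+ 2)) => [w|]; first by rewrite centred_square_sumE; ring.
  by apply: L1D; [apply: L1B => //; exact: L1Z|exact: L1_cst].
rewrite /variance unlock mean0 unlock.
transitivity (\int[P]_w (V w ^+ 2)%:E)%E.
  apply: eq_integral => w _.
  by rewrite -[LHS]/((V w - 0) * (V w - 0))%:E subr0 expr2.
rewrite -[LHS]fineK; last exact: (integrable_fin_num measurableT i2).
congr (_%:E); rewrite -/(Rintegral P setT (fun w => V w ^+ 2)).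
rewrite -/(Ex P (fun w => V w ^+ 2)).
rewrite (eq_Ex P (g := fun w => sqnorm Y w ^+ 2 - 2 * \tr C * sqnorm Y w +
    \tr C ^+ 2)); last by move=> w; rewrite centred_square_sumE; ring.
rewrite ExD; [|by apply: L1B => //; exact: L1Z|exact: L1_cst].
rewrite ExB//; last exact: L1Z.
by rewrite ExZ// Ex_cst Ex_sqnorm_sqr// Ex_sqnorm//; ring.
Qed.

Variable lam : 'I_n -> R.
Hypotheses (lamE : eigenvalues_of C lam) (V0 : (0 < 'V_P[V])%E).
Let lamstar : R := \big[Num.max/0]_(k < n) `|lam k|.

Lemma mxtrace_sqr_gt0 : 0 < \tr (C *m C).
Proof. by move: V0; rewrite centred_square_sum_variance lte_fin pmulr_rgt0. Qed.

Lemma mxtrace_fourth_le :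
  \tr (C *m C *m (C *m C)) <= lamstar ^+ 2 * \tr (C *m C).
Proof.
have e2 := eigenvalues_of_sqr lamE; have e4 := eigenvalues_of_sqr e2.
rewrite (mxtrace_eigenvalues e2) (mxtrace_eigenvalues e4) mulr_sumr.
apply: ler_sum => k _; rewrite expr2 ler_wpM2r ?sqr_ge0//.
rewrite -(ger0_norm (sqr_ge0 (lam k))) normrX ler_pXn2r ?nnegrE//.
  exact: le_bigmax.
by apply: le_trans (normr_ge0 (lam k)) _; exact: le_bigmax.
Qed.

(** The Cauchy-Schwarz inequality between the eigenvalues and the constant 1. *)
Lemma sqr_mxtrace_le : (\tr C) ^+ 2 <= n%:R * \tr (C *m C).
Proof.
rewrite (mxtrace_eigenvalues lamE) (mxtrace_eigenvalues (eigenvalues_of_sqr lamE)).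
set S := \sum_k lam k; set Q := \sum_k lam k ^+ 2.
have [n0|n0] := posnP n.
  have -> : S = 0.
    apply: big1 => k _; have := leq_ltn_trans (leq0n k) (ltn_ord k).
    by rewrite [X in (_ < X)%N]n0.
  by rewrite expr0n mulr_ge0// sumr_ge0// => k _; exact: sqr_ge0.
have h : 0 <= \sum_k (n%:R * lam k - S) ^+ 2 by apply: sumr_ge0 => k _; exact: sqr_ge0.
have e : \sum_k (n%:R * lam k - S) ^+ 2 = n%:R * (n%:R * Q - S ^+ 2).
  transitivity (\sum_k (n%:R ^+ 2 * lam k ^+ 2 - 2 * n%:R * S * lam k) +
      \sum_(k < n) S ^+ 2).
    by rewrite -big_split/=; apply: eq_bigr => k _; ring.
  rewrite sumrB -!mulr_sumr -/S -/Q sumr_const card_ord; ring.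
by move: h; rewrite e pmulr_rge0 ?ltr0n// subr_ge0.
Qed.

Let K : R := Num.sqrt 8 / Num.sqrt (\tr (C *m C)) * lamstar.

(** The relative standard deviation of the kernel is controlled by the ratio of the
    largest eigenvalue to the Euclidean norm of the spectrum. *)
Lemma berry_esseen x :
  normal_cdf x - K <= fine (P [set w | normalized V w < x]) /\
  fine (P [set w | normalized V w <= x]) <= normal_cdf x + K.
Proof.
have t0 := mxtrace_sqr_gt0.
apply: kolmogorov_le => [|h ch h01]; first exact: measurable_funPT.
have -> : (fun w => h (normalized V w)) =
    (fun w => h ((sqnorm Y w - \tr C) / Num.sqrt (2 * \tr (C *m C)))).
  apply/funext => w; rewrite -centred_square_sumE mulrC.
  by rewrite /normalized centred_square_sum_variance.
apply: le_trans (stein_bound gY t0 ch h01) _.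
have L0 : 0 <= lamstar.
  by rewrite /lamstar; elim/big_ind: _ => // a b a0 b0; rewrite le_max a0.
rewrite ler_pdivrMr//.
apply: (@le_trans _ _ (Num.sqrt (8 * (lamstar ^+ 2 * \tr (C *m C))))).
  by rewrite ler_wsqrtr// ler_wpM2l// mxtrace_fourth_le.
rewrite sqrtrM// [X in _ * X <= _]sqrtrM ?sqr_ge0// sqrtr_sqr (ger0_norm L0) /K.
set q := Num.sqrt (\tr (C *m C)); have q0 : q != 0 by rewrite gt_eqF// sqrtr_gt0.
have <- : q ^+ 2 = \tr (C *m C) by rewrite sqr_sqrtr// ltW.
by rewrite le_eqVlt; apply/orP; left; apply/eqP; field.
Qed.

End BerryEsseen.

(** * Convergence in distribution *)

Section Convergence.
Context {d : measure_display} {T : measurableType d} {R : realType}.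
Variable P : probability T R.

Lemma lt_le_prob (F : {RV P >-> R}) (x : R) :
  fine (P [set w | F w < x]) <= fine (P [set w | F w <= x]).
Proof.
have mlt : measurable [set w | F w < x].
  rewrite (_ : [set w | _] = F @^-1` `]-oo, x[); last first.
    by apply/seteqP; split => z /=; rewrite in_itv.
  exact: measurable_funPTI.
have mle : measurable [set w | F w <= x].
  rewrite (_ : [set w | _] = F @^-1` `]-oo, x]); last first.
    by apply/seteqP; split => z /=; rewrite in_itv.
  exact: measurable_funPTI.
apply: fine_le; rewrite ?fin_num_measure//.
by apply: le_measure; rewrite ?inE// => w /= /ltW.
Qed.

Lemma cvg_normal_cdf (F : nat -> {RV P >-> R}) (err : nat -> R) :
  (forall n, (0 < n)%N -> forall x,
    normal_cdf x - err n <= fine (P [set w | F n w < x]) /\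
    fine (P [set w | F n w <= x]) <= normal_cdf x + err n) ->
  err n @[n --> \oo] --> 0 ->
  cvg_in_distribution F (normal_prob 0 1).
Proof.
move=> bnd err0 x _.
suff : cdf (F n) x @[n --> \oo] --> (normal_cdf x)%:E by rewrite -normal_prob_le.
have fin n : cdf (F n) x \is a fin_num by rewrite fin_num_measure.
apply: cvg_EFin; first exact: nearW.
apply/cvgrPdist_le => e e0; move/cvgr0Pnorm_le/(_ e e0) : err0 => err_e.
near=> n.
have n0 : (0 < n)%N by near: n; exists 1%N.
have [h1 h2] := bnd n n0 x; have h3 := lt_le_prob (F n) x.
have he : err n <= e.
  by rewrite (le_trans (ler_norm _))//; near: n; exact: err_e.
have -> : (fine \o (fun n => cdf (F n) x)) n = fine (P [set w | F n w <= x]).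
  have -> : [set w | F n w <= x] = F n @^-1` `]-oo, x].
    by apply/seteqP; split => z /=; rewrite in_itv.
  by [].
rewrite ler_norml; apply/andP; split; lra.
Unshelve. all: by end_near. Qed.

End Convergence.

Lemma little_o_inv_sqrt (R : realType) (u : nat -> R) :
  (u =o_\oo (fun n => (Num.sqrt n%:R)^-1 : R)) <->
  Num.sqrt n%:R * u n @[n --> \oo] --> 0.
Proof.
have s0 n : (0 < n)%N -> 0 < Num.sqrt n%:R :> R by rewrite sqrtr_gt0 ltr0n.
split.
  move=> /eqoP uo; apply/cvgr0Pnorm_le => e e0; have := uo e e0 => ue.
  near=> n; have n0 : (0 < n)%N by near: n; exists 1%N.
  have : `|u n| <= e * `|(Num.sqrt n%:R)^-1| by near: n; exact: ue.
  rewrite normfV (gtr0_norm (s0 n n0)) ler_pdivlMr ?s0// normrM.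
  by rewrite (gtr0_norm (s0 n n0)) mulrC.
move=> /cvgr0Pnorm_le u0; apply/eqoP => e e0; have := u0 e e0 => ue.
near=> n; have n0 : (0 < n)%N by near: n; exists 1%N.
have : `|Num.sqrt n%:R * u n| <= e by near: n; exact: ue.
rewrite normfV (gtr0_norm (s0 n n0)) ler_pdivlMr ?s0// normrM.
by rewrite (gtr0_norm (s0 n n0)) mulrC.
Unshelve. all: by end_near. Qed.

Lemma pos_lower_bound (R : realType) (u : nat -> R) (c : R) : 0 < c ->
  (forall n, (0 < n)%N -> 0 < u n) -> (\forall n \near \oo, c <= u n) ->
  exists2 m : R, 0 < m & forall n, (0 < n)%N -> m <= u n.
Proof.
move=> c0 u0 [N _ uN].
have : exists2 m : R, 0 < m & forall n, (0 < n < N)%N -> m <= u n.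
  elim: N {uN} => [|N [m m0 hm]]; first by exists 1 => // n; rewrite ltn0 andbF.
  have [->|N0] := posnP N.
    by exists 1 => // n; rewrite ltnS leqn0 => /andP[]; case: n.
  exists (Num.min m (u N)); first by rewrite lt_min m0 u0.
  move=> n /andP[n0]; rewrite ltnS leq_eqVlt => /predU1P[->|nN].
    by rewrite ge_min lexx orbT.
  by rewrite ge_min hm// n0.
move=> [m m0 hm]; exists (Num.min m c); first by rewrite lt_min m0.
move=> n n0; have [Nn|nN] := leqP N n.
  by rewrite ge_min (uN n Nn) orbT.
by rewrite ge_min hm// n0.
Qed.

Theorem theorem2p8 (R : realType) (d : measure_display) (T : measurableType d)
    (P : probability T R)
    (I : Type) (X : I -> {RV P >-> R})
    (X_gaussian : centred_gaussian X) (X_separable : separable_process X)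
    (Y : forall n : nat, 'I_n -> {RV P >-> R})
    (Y_gaussian : forall n, (0 < n)%N -> centred_gaussian (Y n))
    (Y_chaos : forall n, (0 < n)%N -> forall k, first_chaos X (Y n k))
    (Y_energy : finite_nonzero_energy Y)
    (lam : forall n : nat, 'I_n -> R)
    (lam_eigen : forall n, (0 < n)%N -> eigenvalues_of (covmx (Y n)) (lam n)) :
  let lamstar n : R := \big[Num.max/0]_(k < n) `|lam n k| in
  let V n : {RV P >-> R} := centred_square_sum (Y n) in
  (forall n, (0 < n)%N -> (0 < 'V_P[V n])%E) ->
  [/\ exists2 C : R, 0 < C & forall n, (0 < n)%N ->
        (ereal_sup [set `|P [set w | (normalized (V n) w < x)%R]
                          - normal_prob 0 1 [set z | (z < x)%R]| | x in [set: R]]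
         <= (C * Num.sqrt n%:R * lamstar n)%:E)%E,
      lamstar =o_\oo (fun n => (Num.sqrt n%:R)^-1 : R) ->
        cvg_in_distribution (fun n => normalized (V n)) (normal_prob 0 1)
    & (fun n => \big[Num.max/0]_(j < n)
                  \sum_(k < n) `|fine 'E_P[Y n k * Y n j]|)
          =o_\oo (fun n => (Num.sqrt n%:R)^-1 : R) ->
        cvg_in_distribution (fun n => normalized (V n)) (normal_prob 0 1)].
Proof.
move=> lamstar V V_gt0.
have ls0 n : 0 <= lamstar n.
  by rewrite /lamstar; elim/big_ind: _ => // a b a0 b0; rewrite le_max a0.
pose t n := \tr (covmx (Y n) *m covmx (Y n)).
have t_gt0 n : (0 < n)%N -> 0 < t n.
  by move=> n0; exact: mxtrace_sqr_gt0 (Y_gaussian n n0) (V_gt0 n n0).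
(* the traces converge to the energy, which is positive; by the Cauchy-Schwarz
   inequality this bounds the Euclidean norm of the spectrum from below *)
have [m m0 tm] : exists2 m : R, 0 < m &
    forall n, (0 < n)%N -> m <= Num.sqrt n%:R * Num.sqrt (t n).
  have [eps eps0 energy] := Y_energy.
  apply: (@pos_lower_bound _ _ (eps / 2)); first by rewrite divr_gt0.
    by move=> n n0; rewrite mulr_gt0// sqrtr_gt0 ?ltr0n// t_gt0.
  have e20 : 0 < eps / 2 by rewrite divr_gt0.
  move/cvgrPdist_le/(_ _ e20) : energy => en.
  near=> n; have n0 : (0 < n)%N by near: n; exists 1%N.
  have h : `|eps - \sum_(k < n) fine 'E_P[Y n k ^+ 2]| <= eps / 2.
    by near: n; exact: en.
  have trE : \sum_(k < n) fine 'E_P[Y n k ^+ 2] = \tr (covmx (Y n)).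
    by apply: eq_bigr => k _; rewrite mxE expr2.
  rewrite trE in h; rewrite -sqrtrM//.
  have h2 : eps / 2 <= \tr (covmx (Y n)).
    by move: h; rewrite ler_norml => /andP[_]; lra.
  rewrite -(ger0_norm (ltW e20)) -sqrtr_sqr ler_wsqrtr//.
  apply: le_trans (sqr_mxtrace_le (lam_eigen n n0)).
  by rewrite ler_pXn2r// nnegrE ?(ltW e20)// (le_trans _ h2)// ltW.
pose c := Num.sqrt 8 / m; have c0 : 0 < c by rewrite divr_gt0// sqrtr_gt0.
have bnd n : (0 < n)%N -> forall x,
    normal_cdf x - c * Num.sqrt n%:R * lamstar n <=
      fine (P [set w | normalized (V n) w < x]) /\
    fine (P [set w | normalized (V n) w <= x]) <=
      normal_cdf x + c * Num.sqrt n%:R * lamstar n.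
  move=> n0 x.
  have [h1 h2] := berry_esseen (Y_gaussian n n0) (lam_eigen n n0) (V_gt0 n n0) x.
  have le : Num.sqrt 8 / Num.sqrt (t n) * lamstar n <= c * Num.sqrt n%:R * lamstar n.
    apply: ler_wpM2r => //; rewrite /c -mulrA; apply: ler_wpM2l; first exact: sqrtr_ge0.
    rewrite ler_pdivlMl// mulrC ler_pdivrMl ?sqrtr_gt0 ?t_gt0//.
    by rewrite mulrC tm.
  rewrite -/(t n) -/(lamstar n) in h1 h2.
  split; [apply: le_trans h1|apply: (le_trans h2)]; lra.
have part2 : lamstar =o_\oo (fun n => (Num.sqrt n%:R)^-1 : R) ->
    cvg_in_distribution (fun n => normalized (V n)) (normal_prob 0 1).
  move=> /little_o_inv_sqrt h; apply: cvg_normal_cdf bnd _.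
  rewrite -(mulr0 c); under eq_fun do rewrite -mulrA.
  by apply: cvgM => //; exact: cvg_cst.
split => //.
- exists c => // n n0; apply: ge_ereal_sup => _ [x _ <-].
  have [h1 h2] := bnd n n0 x; have h3 := lt_le_prob (normalized (V n)) x.
  have mlt : measurable [set w | normalized (V n) w < x].
    rewrite (_ : [set w | _] = normalized (V n) @^-1` `]-oo, x[); last first.
      by apply/seteqP; split => z /=; rewrite in_itv.
    exact: measurable_funPTI.
  rewrite normal_prob_lt -(@fineK _ (P _)) ?fin_num_measure//.
  rewrite -EFinB abse_EFin lee_fin ler_norml; apply/andP; split; lra.
- set M := (fun n => \big[Num.max/0]_(j < n) _) => /little_o_inv_sqrt hM.
  apply: part2; apply/little_o_inv_sqrt; apply: cvg0_le hM => n.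
  have M0 : 0 <= M n.
    rewrite /M; elim/big_ind: _ => // [a b a0 b0|j _]; first by rewrite le_max a0.
    exact: sumr_ge0.
  rewrite !normrM ler_wpM2l// !ger0_norm//.
  have [n0|n0] := posnP n.
    apply: bigmax_le => // k; have := leq_ltn_trans (leq0n k) (ltn_ord k).
    by rewrite [X in (_ < X)%N]n0.
  apply: bigmax_le => // k _; apply: eigenvalue_le_row_sum (lam_eigen n n0) _ => j.
  apply: le_trans (le_bigmax _ (fun j => \sum_(k < n) `|fine 'E_P[Y n k * Y n j]|) j).
  by apply: ler_sum => i _; rewrite mxE.
Unshelve. all: by end_near. Qed.
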